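(* Let $n\geq 1$ and $d$ be integers with $|d|\geq 2$. Define the $d$-sequence of $n$: $n_0=n$, $d_i=\gcd(n_i,|d|)$, $n_{i+1}=n_i/d_i$, and let $k\geq 0$ be the smallest integer with $d_k=1$ (so $n_k=n_{k+1}$); put $m=n_k$, so $n=d_0\cdots d_{k-1}m$ and $\gcd(m,d)=1$. The map $v\mapsto dv$ permutes $\mathbb{Z}_m$; for $v\in\mathbb{Z}_m$ let $o(v)$ be the size of its orbit $\{v,dv,d^2v,\dots\}$. Let $\mathcal{V}$ be a set of representatives of the orbits other than $\{0\}$, chosen so that for every prime $p\mid m$ all numbers $m/p^j$ ($1\leq j\leq \nu_p(m)$) lie in $\mathcal{V}$. For a prime $p\mid m$ let $\pi_p(m)$ be the largest power of $p$ dividing $m$, and for $v\in\mathcal V$ define $c(v)=\pi_p(m)$ if $v=m/\pi_p(m)$ for a prime $p\mid m$ and ($p\neq 2$ or $d\equiv 1 \pmod 4$ or $4\nmid m$); $c(v)=\pi_2(m)/2$ if $v=m/\pi_2(m)$, $d\equiv 3\pmod 4$ and $4\mid m$; $c(v)=2$ if $v=m/2$, $4\mid m$ and $d\equiv 3\pmod 4$; and $c(v)=1$ otherwise. Then the sandpile group of the generalized de Bruijn graph $\mathrm{DB}(n,d)$ (if $d\geq 2$), respectively of the generalized Kautz graph $\mathrm{Ktz}(n,|d|)$ (if $d\leq -2$), is isomorphic to $S(n,d)$, and $$\Sigma(n,d)\cong \Big[\bigoplus_{i=0}^{k-1}\mathbb{Z}_{|d|^{i+1}}^{\,n_i-2n_{i+1}+n_{i+2}}\Big]\oplus\Big[\bigoplus_{v\in\mathcal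 V}\mathbb{Z}_{|d^{o(v)}-1|}\Big],$$ $$S(n,d)\cong \Big[\bigoplus_{i=0}^{k-1}\Big(\mathbb{Z}_{|d|^{i+1}/d_i}\oplus\mathbb{Z}_{|d|^{i+1}}^{\,n_i-2n_{i+1}+n_{i+2}-1}\Big)\Big]\oplus\Big[\bigoplus_{v\in\mathcal V}\mathbb{Z}_{|d^{o(v)}-1|/c(v)}\Big].$$
   Context: For integers $n\ge1$, $d\ge0$: the generalized de Bruijn graph $\mathrm{DB}(n,d)$ has vertex set $\mathbb{Z}_n$ and arcs $v\to dv+i$ ($0\le i\le d-1$) for each $v$; the generalized Kautz graph $\mathrm{Ktz}(n,d)$ has vertex set $\mathbb{Z}_n$ and arcs $v\to -d(v+1)+i$ ($0\le i\le d-1$) (multiple arcs and loops allowed). The Laplacian of a digraph is $\Delta=D-A$, where $A_{v,w}$ is the number of arcs $v\to w$ and $D$ is diagonal with the out-degrees; these digraphs are Eulerian, and the sandpile group is the torsion subgroup of $\mathbb{Z}^{n-1}/\mathbb{Z}^{n-1}\Delta_v$ for the reduced Laplacian $\Delta_v$ (delete row and column $v$), independent of $v$. In the ring $\mathbb{Q}[x]/(x^n-1)$ (where $x^a$ for any integer $a$ depends only on $a \bmod n$) put $e_v=x^v-1$ and $\epsilon_v=d\,e_v-e_{dv}$ for $v\in\mathbb{Z}_n$. Let $\mathcal Z_n$ be the $\mathbb{Z}$-span of $e_1,\dots,e_{n-1}$, $\mathcal E_{n,d}$ the $\mathbb{Z}$-span of $\epsilon_1,\dots,\epsilon_{n-1}$,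 and $\Sigma(n,d)=\mathcal Z_n/\mathcal E_{n,d}$ (the sand dune group). Let $f_v=d\,x^v-x^{dv}(x^d-1)/(x-1)$, i.e. $f_v=dx^v-\sum_{i=0}^{d-1}x^{dv+i}$ if $d\ge2$ and $f_v=dx^v+\sum_{i=0}^{|d|-1}x^{d(v+1)+i}$ if $d\le-2$, and $S(n,d)=\mathcal Z_n/\langle f_1,\dots,f_{n-1}\rangle_{\mathbb{Z}}$. $\nu_p(m)$ is the exponent of $p$ in $m$. *)

(* Defs.v *)
From HB Require Import structures.
From mathcomp Require Import all_boot all_order all_algebra.
From mathcomp Require Import boolp.

Set Implicit Arguments.
Unset Strict Implicit.
Unset Printing Implicit Defensive.

Import Order.TTheory GRing.Theory Num.Theory.
Local Open Scope ring_scope.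

(* The cyclic group Z_q, for q >= 1. The ring types 'Z_q are avoided because
   'Z_1 is Z/2, whereas trivial factors do occur here. *)
Notation Zmod q := ('I_(q.-1.+1)).

Definition zmod_isog (G H : zmodType) : Prop :=
  exists f : {additive G -> H}, bijective f.

Fixpoint cyclic_sum (s : seq nat) : zmodType :=
  if s is q :: s' then (Zmod q * cyclic_sum s')%type else 'I_1.

Section Spans.
Variable V : zmodType.

Definition zspan (s : seq V) : {pred V} :=
  fun v => `[< inIntSpan (in_tuple s) v >].

Fact zspan_zmod_closed s : zmod_closed (zspan s).
Proof.
split=> [|u v /asboolP[a ->] /asboolP[b ->]]; apply/asboolP.
  by exists 0; rewrite big1 // => i _; rewrite ffunE mulr0z.
exists (a - b); rewrite -sumrB; apply: eq_bigr => i _.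
by rewrite !ffunE mulrzBr.
Qed.

HB.instance Definition _ s :=
  GRing.isZmodClosed.Build V (zspan s) (zspan_zmod_closed s).

Lemma mem_zspan s v : v \in s -> v \in zspan s.
Proof.
move=> /(nthP 0)[i li <-]; apply/asboolP.
exists [ffun j : 'I_(size s) => (j == Ordinal li)%:Z].
rewrite (bigD1 (Ordinal li)) //= ffunE eqxx mulr1z big1 ?addr0 // => j.
by move=> /negPf jn; rewrite ffunE jn mulr0z.
Qed.

Record span_of (s : seq V) := SpanOf {
  span_val : V;
  _ : span_val \in zspan s
}.

HB.instance Definition _ s := [isSub for @span_val s].
HB.instance Definition _ s := [Choice of span_of s by <:].
HB.instance Definition _ s := [SubChoice_isSubZmodule of span_of s by <:].

Definition subspan (s t : seq V) : {pred span_of s} :=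
  fun u => val u \in zspan t.

Fact subspan_zmod_closed s t : zmod_closed (@subspan s t).
Proof.
have E u : (u \in @subspan s t) = (val u \in zspan t) by [].
by split=> [|u v]; rewrite !E ?raddf0 ?rpred0 // raddfB; exact: rpredB.
Qed.

HB.instance Definition _ s t :=
  GRing.isZmodClosed.Build (span_of s) (@subspan s t) (subspan_zmod_closed s t).

(* <s>_Z / <t>_Z, meant for t included in <s>_Z *)
Definition span_quot (s t : seq V) : zmodType := Quotient.quot (@subspan s t).

Definition torsion : {pred V} :=
  fun x => `[< exists2 k : nat, (0 < k)%N & x *+ k = 0 >].

Fact torsion_zmod_closed : zmod_closed torsion.
Proof.
split=> [|u v /asboolP[j j0 ju] /asboolP[k k0 kv]]; apply/asboolP.
  by exists 1%N; rewrite ?mul0rn.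
exists (j * k)%N; first by rewrite muln_gt0 j0.
by rewrite mulrnBl mulrnA ju mul0rn mulnC mulrnA kv mul0rn subr0.
Qed.

HB.instance Definition _ :=
  GRing.isZmodClosed.Build V torsion torsion_zmod_closed.

Record torsion_subgroup := TorsionSubgroup {
  torsion_val : V;
  _ : torsion_val \in torsion
}.

HB.instance Definition _ := [isSub for torsion_val].
HB.instance Definition _ := [Choice of torsion_subgroup by <:].
HB.instance Definition _ := [SubChoice_isSubZmodule of torsion_subgroup by <:].

End Spans.

Section RowLattice.
Variables (m n : nat) (M : 'M[int]_(m, n)).

Definition row_lattice : {pred 'rV[int]_n} :=
  fun u => `[< exists w : 'rV[int]_m, u = w *m M >].

Fact row_lattice_zmod_closed : zmod_closed row_lattice.
Proof.
split=> [|u v /asboolP[a ->] /asboolP[b ->]]; apply/asboolP.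
  by exists 0; rewrite mul0mx.
by exists (a - b); rewrite mulmxBl.
Qed.

HB.instance Definition _ :=
  GRing.isZmodClosed.Build 'rV[int]_n row_lattice row_lattice_zmod_closed.

Definition cokernel : zmodType := Quotient.quot row_lattice.

End RowLattice.

Record digraph (N : nat) := Digraph {
  arc : finType;
  src : arc -> 'I_N;
  tgt : arc -> 'I_N
}.

Definition adjacency N (G : digraph N) : 'M[int]_N :=
  \matrix_(v, w) (#|[set a : arc G | (src a == v) && (tgt a == w)]|)%:Z.

Definition outdegree N (G : digraph N) (v : 'I_N) : nat :=
  #|[set a : arc G | src a == v]|.

Definition laplacian N (G : digraph N) : 'M[int]_N :=
  diag_mx (\row_v (outdegree G v)%:Z) - adjacency G.

Definition reduced_laplacian N (G : digraph N) (v : 'I_N) : 'M[int]_N.-1 :=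
  row' v (col' v (laplacian G)).

Definition sandpile_group N (G : digraph N) (v : 'I_N) : zmodType :=
  torsion_subgroup (cokernel (reduced_laplacian G v)).

Definition DB (n d : nat) : digraph n.-1.+1 :=
  @Digraph n.-1.+1 (Zmod n * 'I_d)%type (fun a => a.1)
    (fun a => a.1 *+ d + inZp a.2).

Definition Ktz (n d : nat) : digraph n.-1.+1 :=
  @Digraph n.-1.+1 (Zmod n * 'I_d)%type (fun a => a.1)
    (fun a => - ((a.1 + inZp 1) *+ d) + inZp a.2).

Section SandDune.
Variables (n : nat) (d : int).

Local Notation Qn := {poly %/ ('X^n - 1 : {poly rat})}.

Definition xpow (a : int) : Qn := in_qpoly _ 'X^(`|(a %% n)%Z|%N).

Definition dune_e (v : int) : Qn := xpow v - 1.

Definition dune_eps (v : int) : Qn := dune_e v *~ d - dune_e (d * v).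

Definition lap_f (v : int) : Qn :=
  if 0 <= d then
    xpow v *~ d - \sum_(i < `|d|%N) xpow (d * v + i%:Z)
  else
    xpow v *~ d + \sum_(i < `|d|%N) xpow (d * (v + 1) + i%:Z).

(* the family g_1, ..., g_{n-1} *)
Definition nonzero_family (g : int -> Qn) : seq Qn :=
  [seq g i%:Z | i <- iota 1 n.-1].

Lemma dune_e_span a : (0 < n)%N ->
  dune_e a \in zspan (nonzero_family dune_e).
Proof.
move=> n0; have/andP[L0 L1] : (0 <= (a %% n)%Z < n%:Z)%R.
  by rewrite modz_ge0 ?ltz_pmod //; case: (n) n0.
have -> : dune_e a = dune_e (`|(a %% n)%Z|%N)%:Z.
  by rewrite /dune_e /xpow gez0_abs ?modz_mod.
case: (posnP `|(a %% n)%Z|%N) => [->|p].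
  by rewrite /dune_e /xpow mod0z expr0 rmorph1 subrr rpred0.
apply: mem_zspan; apply: (map_f (fun i : nat => dune_e i%:Z)).
by rewrite mem_iota p add1n prednK // -ltz_nat gez0_abs.
Qed.

Lemma dune_eps_span v : (0 < n)%N ->
  dune_eps v \in zspan (nonzero_family dune_e).
Proof. by move=> n0; rewrite rpredB ?rpredMz ?dune_e_span. Qed.

Lemma lap_f_span v : (0 < n)%N ->
  lap_f v \in zspan (nonzero_family dune_e).
Proof.
move=> n0; have X a : xpow a = dune_e a + 1 by rewrite subrK.
rewrite /lap_f; case: ifP => d0; under eq_bigr do rewrite X;
  rewrite X big_split /= mulrzDl sumr_const card_ord ?opprD addrACA.
  have -> : 1 *~ d - 1 *+ `|d|%N = 0 :> Qn.
    by rewrite -{1}(gez0_abs d0) -pmulrn subrr.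
  by rewrite addr0 rpredB ?rpredMz ?rpred_sum // => *; rewrite ?dune_e_span.
have -> : 1 *~ d + 1 *+ `|d|%N = 0 :> Qn.
  have -> : d = - (`|d|%N)%:Z by rewrite abszE ltr0_norm ?opprK // ltNge d0.
  by rewrite abszN mulrNz absz_nat -pmulrn addNr.
by rewrite addr0 rpredD ?rpredMz ?rpred_sum // => *; rewrite ?dune_e_span.
Qed.

Definition sand_dune_group : zmodType :=
  span_quot (nonzero_family dune_e) (nonzero_family dune_eps).

Definition S_group : zmodType :=
  span_quot (nonzero_family dune_e) (nonzero_family lap_f).

End SandDune.

Fixpoint dseq_n (n : nat) (d : int) (i : nat) : nat :=
  if i is i'.+1 then (dseq_n n d i' %/ gcdn (dseq_n n d i') `|d|)%N else n.

Definition dseq_d (n : nat) (d : int) (i : nat) : nat :=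
  gcdn (dseq_n n d i) `|d|%N.

Definition dseq_stop (n : nat) (d : int) (k : nat) : Prop :=
  dseq_d n d k = 1%N /\ forall j, (j < k)%N -> dseq_d n d j <> 1%N.

Lemma dseq_stop_exists (n : nat) (d : int) :
  (0 < n)%N -> exists k, dseq_stop n d k.
Proof.
move=> n0; have P i : (0 < dseq_n n d i)%N.
  elim: i => //= i IH; rewrite divn_gt0 ?gcdn_gt0 ?IH //.
  by rewrite dvdn_leq ?dvdn_gcdl.
have ex : exists k, dseq_d n d k == 1%N.
  apply: contrapT => /forallNP N.
  have D i : (dseq_n n d i + i <= n)%N.
    elim: i => [|i IH]; first by rewrite addn0.
    apply: leq_trans IH; rewrite addnS -addSn leq_add2r /= ltn_Pdiv //.
    have := N i; rewrite /dseq_d => /negP.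
    have : (0 < gcdn (dseq_n n d i) `|d|)%N by rewrite gcdn_gt0 P.
    by case: gcdn => [|[]].
  have := D n; have := P n.
  by case: (dseq_n _ _ n) => // x _; rewrite addSn ltnNge leq_addl.
case: (ex_minnP ex) => k /eqP ? min; exists k; split=> // j jk /eqP /min.
by rewrite leqNgt jk.
Qed.

(* n_i - 2 n_{i+1} + n_{i+2}; reordered to avoid truncation *)
Definition dseq_exp (n : nat) (d : int) (i : nat) : nat :=
  (dseq_n n d i + dseq_n n d i.+2 - 2 * dseq_n n d i.+1)%N.

Section Orbits.
Variables (m : nat) (d : int).
Implicit Types v w : Zmod m.

Definition dorbit v : {set Zmod m} :=
  [set w | fconnect (fun u : Zmod m => u *~ d) v w].

Definition orbit_representatives (X : {set Zmod m}) : Prop :=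
  is_transversal X [set dorbit v | v in [set~ 0]] [set~ 0]
  /\ forall p j : nat, prime p -> (p %| m)%N -> (1 <= j <= logn p m)%N ->
       inZp (m %/ p ^ j) \in X.

(* m`_p is the largest power of p dividing m; the filtered list has at most
   one element. *)
Definition cfactor v : nat :=
  if [seq p : nat <- primes m | (nat_of_ord v == m %/ m`_p)%N
        && [|| p != 2%N, (d == 1 %[mod 4])%Z | ~~ (4 %| m)%N]] is p :: _
  then m`_p
  else if [&& (nat_of_ord v == m %/ m`_2)%N, (d == 3 %[mod 4])%Z
        & (4 %| m)%N]
  then (m`_2 %/ 2)%N
  else if [&& (nat_of_ord v == m %/ 2)%N, (4 %| m)%N & (d == 3 %[mod 4])%Z]
  then 2%N
  else 1%N.

End Orbits.

Definition sigma_orders (n : nat) (d : int) (k : nat)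
    (X : {set Zmod (dseq_n n d k)}) : seq nat :=
  flatten [seq nseq (dseq_exp n d i) (`|d| ^ i.+1)%N | i <- iota 0 k]
  ++ [seq `|(d ^+ #|dorbit d v| - 1)%R|%N | v <- enum X].

Definition S_orders (n : nat) (d : int) (k : nat)
    (X : {set Zmod (dseq_n n d k)}) : seq nat :=
  flatten [seq (`|d| ^ i.+1 %/ dseq_d n d i)%N
                 :: nseq (dseq_exp n d i - 1) (`|d| ^ i.+1)%N | i <- iota 0 k]
  ++ [seq (`|(d ^+ #|dorbit d v| - 1)%R| %/ cfactor d v)%N | v <- enum X].

(* Main.v *)
Require Import Defs.
From HB Require Import structures.
From mathcomp Require Import all_boot all_order all_algebra.
From mathcomp Require Import boolp.
From mathcomp Require Import zify ring.

Set Implicit Arguments.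
Unset Strict Implicit.
Unset Printing Implicit Defensive.

Import Order.TTheory GRing.Theory Num.Theory.
Local Open Scope ring_scope.

(** Write [e_v] for the class of [x^v - 1] in the sand dune group [Sigma], so
    that [Sigma] is generated by the [e_v], [v] in [Z_n], with the relations
    [e_0 = 0] and [d e_v = e_(dv)].  Multiplication by [x - 1] is injective on
    the augmentation ideal and sends [f_v] to [eps_(v+1) - eps_v]; hence it
    identifies [S(n,d)] with the kernel of [tau : Sigma -> Z_n, e_v |-> v].

    The functional graph of [v |-> d v] consists of cycles, on [d^k Z_n], with
    trees attached.  Choose for every [w] in [d Z_n] a preimage [c w] that lies
    as deep as possible in the filtration [d^i Z_n].  Every [u] of depth [i]
    with [u <> c (d u)] ends a chain and yields
    [e_(c^i u) - e_(c^(i+1) (d u))], of order [d^(i+1)]; together with one [e_v]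
    for each non-zero cycle these elements form a basis of [Sigma], as explicit
    dual functionals show.

    A triangular change of basis then moves all but a few basis elements into
    the kernel of [tau].  On the trees one chain of each length survives.  On
    the cycles the survivors sit at [m/p^a] with [p^a] the [p]-part of [m]
    (and at [m/2] if [d = 3 mod 4] and [4 | m]); that the correcting terms
    respect the orders is the lifting-the-exponent lemma. *)

(** * Kernels in terms of dual bases *)

(** A homomorphism from Sigma to Z_q is the same thing as a function phi on Z_n with phi(0) = 0 and
    phi(dv) = d phi(v). Independence of the basis is therefore tested by writing such functions
    down, without determinants or group orders, and [tau] is the case phi = identity. The obstacle
    is that a basis of Sigma does not restrict to the kernel of [tau]: the term that cancels the
    value of a generator must itself be killed by the reduced order. On the trees this works because
    n_i generates the kernel of d^i on Z_n. On the cycles m and the cofactors m/p^a together have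
    greatest common divisor 1, so values can be cancelled one prime at a time. If d = 3 mod 4, then
    d^2 - 1 has at least two more factors 2 than d - 1; lifting the exponent fails there, whence the
    exceptional values of c(v) at m/2^a and m/2. *)

Definition additive_of (U V : zmodType) (f : U -> V)
    (fB : {morph f : x y / x - y}) : {additive U -> V} :=
  HB.pack f (GRing.isZmodMorphism.Build U V f fB).

(** Allows the kernel of [tau] to be handled purely as a common image: S and the cyclic sum are each
    embedded in Sigma, and the kernel itself never becomes a type. *)
Lemma zmod_isog_same_image (A B G : zmodType) (f : {additive A -> G})
    (g : {additive B -> G}) : injective f -> injective g ->
  (forall x, (exists a, f a = x) <-> (exists b, g b = x)) -> zmod_isog A B.
Proof.
move=> fI gI fg.
have /choice[u uE] : forall a, exists b, g b = f a.
  by move=> a; apply/fg; exists a.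
have /choice[w wE] : forall b, exists a, f a = g b.
  by move=> b; apply/fg; exists b.
have uB : {morph u : x y / x - y}.
  by move=> x y; apply: gI; rewrite raddfB /= !uE raddfB.
exists (additive_of uB); exists w => x.
  by apply: fI; rewrite wE uE.
by apply: gI; rewrite uE wE.
Qed.

(** Reduction modulo [q], written as a multiple of 1 so that additivity is immediate. [Zmod 0] is
    trivial, not Z; this is why divisibility criteria below ask for [0 < q]. *)
Definition zc (q : nat) (a : int) : Zmod q := inZp 1 *~ a.

Lemma zcD q a b : zc q (a + b) = zc q a + zc q b.
Proof. exact: mulrzDr. Qed.
Lemma zcN q a : zc q (- a) = - zc q a.
Proof. exact: mulrNz. Qed.
Lemma zcB q a b : zc q (a - b) = zc q a - zc q b.
Proof. exact: mulrzBr. Qed.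
Lemma zc0 q : zc q 0 = 0.
Proof. exact: mulr0z. Qed.
Lemma zcMz q a b : zc q a *~ b = zc q (a * b).
Proof. by rewrite /zc mulrzA. Qed.

Lemma zc_nat q (b : nat) : zc q b = inZp b.
Proof.
rewrite /zc -pmulrn Zp_mulrn; apply: val_inj => /=.
by rewrite modnMml mul1n.
Qed.

Lemma zc_val q (x : Zmod q) : zc q (x : nat)%:Z = x.
Proof. by rewrite zc_nat valZpK. Qed.

Lemma zc_eq0 q a : (0 < q)%N -> (zc q a == 0) = (q %| a)%Z.
Proof.
move=> q0; have H (b : nat) : (zc q b%:Z == 0) = (q %| b%:Z)%Z.
  by rewrite zc_nat -val_eqE /= prednK // -dvdnE dvdzE.
by case: (intP a) => [|b|b]; rewrite ?zcN ?oppr_eq0 ?rpredN H.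
Qed.

Lemma zc_eq q a b : (0 < q)%N -> (zc q a == zc q b) = (q %| a - b)%Z.
Proof. by move=> q0; rewrite -subr_eq0 -zcB zc_eq0. Qed.

Lemma zc_mod q (a : int) : (0 < q)%N -> ((zc q a : nat)%:Z = (a %% q)%Z).
Proof.
move=> q0; have: (zc q (a %% q)%Z == zc q a).
  by rewrite zc_eq // {2}(divz_eq a q) opprD addrCA subrr addr0 rpredN dvdz_mull.
move/eqP<-; have/andP[L0 L1] : (0 <= (a %% q)%Z < q%:Z)%R.
  by rewrite modz_ge0 ?ltz_pmod //; lia.
move: L0 L1; case: (a %% q)%Z => // b _ L1.
by rewrite zc_nat /= prednK // modn_small.
Qed.

Section SubtractionClosed.
Variables (U : zmodType) (P : U -> Prop).
Hypothesis (P0 : P 0) (PB : forall x y, P x -> P y -> P (x - y)).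

Lemma closedN x : P x -> P (- x).
Proof. by rewrite -(sub0r x); apply: PB. Qed.

Lemma closedD x y : P x -> P y -> P (x + y).
Proof. by move=> Px /closedN Py; rewrite -(opprK y); apply: PB. Qed.

Lemma closedMz x (a : int) : P x -> P (x *~ a).
Proof.
have H (m : nat) : P x -> P (x *+ m).
  by move=> Px; elim: m => [|m IH]; rewrite ?mulr0n // mulrS; apply: closedD.
move=> Px; case: a => m; first by rewrite -pmulrn; apply: H.
by rewrite NegzE mulrNz -pmulrn; apply/closedN/H.
Qed.

Lemma closed_sum (J : Type) (r : seq J) (Q : pred J) (F : J -> U) :
  (forall j, Q j -> P (F j)) -> P (\sum_(j <- r | Q j) F j).
Proof. by move=> H; apply: big_ind => //; apply: closedD. Qed.

Lemma zspan_ind (s : seq U) : {in s, forall x, P x} -> {in zspan s, forall x, P x}.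
Proof.
move=> Ps x /asboolP[a ->]; apply: closed_sum => i _; apply: closedMz.
by apply: Ps; rewrite mem_nth.
Qed.

End SubtractionClosed.

Section Span.
Variables (G : zmodType) (I : eqType) (g : I -> G) (s : seq I).

Definition spanned (P : pred I) (x : G) : Prop :=
  exists b : I -> int, x = \sum_(i <- s | P i) g i *~ b i.

Lemma spanned0 P : spanned P 0.
Proof. by exists (fun _ => 0); rewrite big1 // => i _; rewrite mulr0z. Qed.

Lemma spannedB P x y : spanned P x -> spanned P y -> spanned P (x - y).
Proof.
move=> [b ->] [c ->]; exists (fun i => b i - c i).
by rewrite -sumrB; apply: eq_bigr => i _; rewrite mulrzBr.
Qed.

Lemma spannedN P x : spanned P x -> spanned P (- x).
Proof. by rewrite -(sub0r x); apply/spannedB/spanned0. Qed.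

Lemma spannedD P x y : spanned P x -> spanned P y -> spanned P (x + y).
Proof. by move=> Px /spannedN Py; rewrite -(opprK y); apply: spannedB. Qed.

Lemma spannedMz P x a : spanned P x -> spanned P (x *~ a).
Proof.
move=> [b ->]; exists (fun i => b i * a).
by rewrite mulrz_suml; apply: eq_bigr => i _; rewrite mulrzA.
Qed.

Lemma spanned_sum P (J : Type) (r : seq J) (Q : pred J) (F : J -> G) :
  (forall j, Q j -> spanned P (F j)) -> spanned P (\sum_(j <- r | Q j) F j).
Proof.
by move=> H; apply: big_ind => //; [exact: spanned0|exact: spannedD].
Qed.

Lemma spanned_gen (P : pred I) i : uniq s -> i \in s -> P i -> spanned P (g i).
Proof.
move=> us si Pi; exists (fun j => (j == i)%:Z).
rewrite big_mkcond (bigD1_seq i) //= Pi eqxx mulr1z big1 ?addr0 // => j.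
by move=> /negPf->; rewrite mulr0z if_same.
Qed.

Lemma spanned_sub (P Q : pred I) x :
  (forall i, i \in s -> P i -> Q i) -> spanned P x -> spanned Q x.
Proof.
move=> PQ [b ->]; exists (fun i => if P i then b i else 0).
rewrite big_seq_cond [RHS]big_seq_cond [RHS](bigID P) /=.
rewrite [X in _ = _ + X]big1; last first.
  by move=> i /andP[_ /negPf->]; rewrite mulr0z.
rewrite addr0; apply: eq_big => [i|i /andP[_ ->]//].
by case si: (i \in s) => //=; case Pi: (P i); rewrite ?andbF // PQ.
Qed.

Lemma spanned_ind (P : pred I) (Q : G -> Prop) : Q 0 ->
  (forall x y, Q x -> Q y -> Q (x - y)) ->
  (forall i, i \in s -> P i -> Q (g i)) -> forall x, spanned P x -> Q x.
Proof.
move=> Q0 QB Qg x [b ->]; rewrite big_seq_cond.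
apply: (closed_sum Q0 QB) => i /andP[si Pi].
by apply: (closedMz Q0 QB); apply: Qg.
Qed.

End Span.

Section CyclicSum.
Variables (G : zmodType) (I : eqType) (q : I -> nat) (h : I -> G).

(** Every element is described by integer coefficients that detect zero by divisibility. Injectivity
    thus becomes a statement about relations between the [h i], and later arguments need not compute
    in the iterated product. *)
Lemma cyclic_sum_map (s : seq I) : uniq s ->
  {in s, forall i, 0 < q i}%N -> {in s, forall i, h i *+ q i = 0} ->
  exists f : {additive cyclic_sum (map q s) -> G},
    (forall x, exists2 b : I -> int, f x = \sum_(i <- s) h i *~ b i &
        {in s, forall i, (q i %| b i)%Z} -> x = 0) /\
    (forall b : I -> int, exists x, f x = \sum_(i <- s) h i *~ b i).
Proof.
elim: s => [|i s IH] us q0 hq.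
  have f0 : {morph (fun _ : cyclic_sum [::] => 0 : G) : x y / x - y}.
    by move=> x y; rewrite subrr.
  exists (additive_of f0); split=> [x|b].
    exists (fun _ => 0); rewrite ?big_nil // => _.
    by apply: val_inj; case: x => [] [].
  by exists 0; rewrite big_nil.
move: us => /= /andP[si us].
have q0' : {in s, forall j, 0 < q j}%N.
  by move=> j sj; apply: q0; rewrite inE sj orbT.
have hq' : {in s, forall j, h j *+ q j = 0}.
  by move=> j sj; apply: hq; rewrite inE sj orbT.
have [f [f1 f2]] := IH us q0' hq'.
have qi0 : (0 < q i)%N by apply: q0; rewrite inE eqxx.
have hi : h i *+ q i = 0 by apply: hq; rewrite inE eqxx.
have hz (a b : int) : zc (q i) a = zc (q i) b -> h i *~ a = h i *~ b.
  move/eqP; rewrite zc_eq // => /dvdzP[c e]; apply/eqP.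
  rewrite -subr_eq0 -mulrzBr e mulrC.
  by rewrite mulrzA -pmulrn /= hi mul0rz.
pose F (x : cyclic_sum (map q (i :: s))) : G := h i *+ (x.1 : nat) + f x.2.
have FB : {morph F : x y / x - y}.
  case=> x x' [y y']; rewrite /F /= raddfB opprD addrACA; congr (_ + _).
  rewrite [LHS]pmulrn [h i *+ x]pmulrn [h i *+ y]pmulrn -mulrzBr.
  by apply: hz; rewrite zcB !zc_val; exact: (zc_val (x - y)).
exists (additive_of FB); split=> [[x x']|b].
  rewrite /= /F /=; have [b fb bq] := f1 x'.
  exists (fun j => if j == i then (x : nat)%:Z else b j).
    rewrite big_cons eqxx fb -pmulrn; congr (_ + _).
    by apply: eq_big_seq => j sj; case: eqP => // ji; rewrite -ji sj in si.
  move=> dv; congr pair.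
    have := dv i; rewrite inE eqxx => /(_ isT) /=.
    by rewrite -zc_eq0 // zc_val => /eqP.
  apply: bq => j sj; have := dv j; rewrite inE sj orbT => /(_ isT).
  by case: eqP => // ji; rewrite -ji sj in si.
have [x' xE] := f2 b.
exists (zc (q i) (b i), x'); rewrite /= /F /= big_cons xE; congr (_ + _).
by rewrite pmulrn; apply: hz; rewrite zc_val.
Qed.

Lemma cyclic_sum_injection (s : seq I) : uniq s ->
  {in s, forall i, 0 < q i}%N -> {in s, forall i, h i *+ q i = 0} ->
  (forall b : I -> int, \sum_(i <- s) h i *~ b i = 0 ->
     {in s, forall i, (q i %| b i)%Z}) ->
  exists f : {additive cyclic_sum (map q s) -> G},
    injective f /\ forall x, (exists y, f y = x) <-> spanned h s predT x.
Proof.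
move=> us q0 hq ind; have [f [f1 f2]] := cyclic_sum_map us q0 hq.
exists f; split.
  apply/raddf_inj => x fx; have [b fb] := f1 x; apply.
  by apply: ind; rewrite -fb fx.
move=> x; split=> [[y <-]|[b ->]]; last exact: f2.
by have [b -> _] := f1 y; exists b.
Qed.

End CyclicSum.

Section Triangular.
Variables (G T : zmodType) (tau : {additive G -> T}).
Variables (I : eqType) (s : seq I) (g z : I -> G) (q q' al rk : I -> nat).
Hypothesis us : uniq s.
Hypothesis q'_gt0 : {in s, forall i, 0 < q' i}%N.
Hypothesis al_gt0 : {in s, forall i, 0 < al i}%N.
Hypothesis qE : {in s, forall i, q i = q' i * al i}%N.
Hypothesis gq : {in s, forall i, g i *+ q i = 0}.
Hypothesis dual : {in s, forall i, exists2 lam : {additive G -> Zmod (q i)},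
  lam (g i) = zc (q i) 1 & {in s, forall j, j != i -> lam (g j) = 0}}.
Hypothesis gen : forall x, spanned g s predT x.

(** The functional dual to [g i], applied to a relation, leaves the coefficient of [g i] modulo
    [q i]. *)
Lemma dual_basis_isog : zmod_isog G (cyclic_sum (map q s)).
Proof.
have q0 : {in s, forall i, 0 < q i}%N.
  by move=> i si; rewrite qE // muln_gt0 q'_gt0 ?al_gt0.
have [|f [fI fim]] := cyclic_sum_injection us q0 gq.
  move=> b sb i si; have [lam l1 l0] := dual si.
  have := congr1 lam sb; rewrite raddf_sum raddf0 (bigD1_seq i) //= big_seq_cond.
  rewrite big1 => [|j /andP[sj ji]].
    by rewrite addr0 raddfMz l1 zcMz mul1r => /eqP; rewrite zc_eq0 ?q0.
  by rewrite raddfMz l0 ?mul0rz.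
apply: (zmod_isog_same_image (f := idfun) (g := f)) => // x.
split=> _; last by exists x.
exact/fim/gen.
Qed.

(* [h_i = al_i g_i + z_i] lies in the kernel of [tau], and [z_i] only involves
   generators of larger rank.  By [star], in an element of the kernel the
   coefficient of [g_i] is divisible by [al_i] once the generators of smaller
   rank have been eliminated. *)
Hypothesis zq : {in s, forall i, z i *+ q' i = 0}.
Hypothesis z_span : {in s, forall i, spanned g s [pred l | rk i < rk l]%N (z i)}.
Hypothesis tau_h : {in s, forall i, tau (g i *+ al i + z i) = 0}.
Hypothesis al1 : {in s, forall i, rk i = 0%N -> al i = 1%N}.
Hypothesis star : {in s, forall i, (0 < rk i)%N -> forall b y,
  spanned g s [pred l | (l != i) && (rk i <= rk l)%N] y ->
  tau (g i *~ b + y) = 0 -> (al i %| b)%Z}.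

Let h i := g i *+ al i + z i.

Let hz i : i \in s -> h i *+ q' i = 0.
Proof.
by move=> si; rewrite mulrnDl zq // -mulrnA mulnC -qE // gq // addr0.
Qed.

(** Strong induction on the rank, applying the functional dual to [g i]. It kills [h j *~ b j] for
    every other [j]: for smaller rank because [q' j] already divides [b j], otherwise because [z j]
    only involves ranks above [rk i]. What remains says that [q' i * al i] divides [al i * b i]. *)
Let h_indep (b : I -> int) : \sum_(i <- s) h i *~ b i = 0 ->
  {in s, forall i, (q' i %| b i)%Z}.
Proof.
move=> sb i si; have [r] := ubnP (rk i); elim: r i si => // r IH i si ri.
have [lam l1 l0] := dual si.
have lh j : j \in s -> j != i -> lam (h j *~ b j) = 0.
  move=> sj ji; have [rji|rij] := ltnP (rk j) (rk i).
    have /dvdzP[c ->] := IH j sj (leq_trans rji ri).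
    by rewrite mulrC mulrzA -pmulrn hz // mul0rz raddf0.
  rewrite raddfMz /h raddfD raddfMn /= l0 // mul0rn add0r.
  suff -> : lam (z j) = 0 by rewrite mul0rz.
  have := z_span sj; apply: (@spanned_ind _ _ _ _ _ (fun x => lam x = 0)).
  - exact: raddf0.
  - by move=> x y lx ly; rewrite raddfB /= lx ly subrr.
  move=> l sl /= rl; apply: l0 => //; apply: contraTneq rl => ->.
  by rewrite -leqNgt.
have li : lam (h i *~ b i) = zc (q i) ((al i)%:Z * b i).
  rewrite raddfMz /h raddfD raddfMn /= l1 pmulrn zcMz mul1r.
  suff -> : lam (z i) = 0 by rewrite addr0 zcMz.
  have := z_span si; apply: (@spanned_ind _ _ _ _ _ (fun x => lam x = 0)).
  - exact: raddf0.
  - by move=> x y lx ly; rewrite raddfB /= lx ly subrr.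
  move=> l sl /= rl; apply: l0 => //; apply: contraTneq rl => ->.
  by rewrite ltnn.
have := congr1 lam sb; rewrite raddf_sum raddf0 (bigD1_seq i) //= big_seq_cond.
rewrite big1 => [|j /andP[sj ji]]; last exact: lh.
rewrite addr0 li => /eqP; rewrite zc_eq0; last first.
  by rewrite qE // muln_gt0 q'_gt0 ?al_gt0.
by rewrite qE // PoszM [(al i)%:Z * _]mulrC dvdz_mul2r // -lt0n al_gt0.
Qed.

(** Once the coefficients in rank [r] are known to be divisible by [al], multiples of the [h i] of
    that rank can be subtracted. The remainder is still in the kernel and involves larger ranks
    only, so the induction is on [N - r]. *)
Let elim_rank (r N : nat) x : {in s, forall i, rk i < N}%N ->
  spanned g s [pred l | r <= rk l]%N x -> tau x = 0 -> spanned h s predT x.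
Proof.
move=> rN; have [e] := ubnP (N - r); elim: e r x => // e IH r x re [b xE] tx.
have [Nr|rNr] := leqP N r.
  rewrite xE big_seq_cond big1 => [|i /andP[si /= ri]]; first exact: spanned0.
  by have := rN i si; rewrite ltnNge (leq_trans Nr).
have dv i : i \in s -> rk i = r -> (al i %| b i)%Z.
  move=> si ri; case: (posnP r) => [r0|rp]; first by rewrite al1 ?ri ?dvd1z.
  pose y := \sum_(l <- s | (r <= rk l)%N && (l != i)) g l *~ b l.
  have rp' : (0 < rk i)%N by rewrite ri.
  have := star si rp'; move=> /(_ (b i) y); apply.
    by exists b; apply: eq_bigl => l /=; rewrite ri andbC.
  move: tx; rewrite xE big_mkcond (bigD1_seq i si us) /= ri leqnn.
  by rewrite -big_mkcondl.
pose c i := (b i %/ al i)%Z.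
have bE i : i \in s -> rk i = r -> b i = (al i)%:Z * c i.
  by move=> si ri; rewrite mulrC divzK ?dv.
pose w := \sum_(i <- s | rk i == r) h i *~ c i.
have wh : spanned h s predT w.
  by apply: (@spanned_sub _ _ _ _ [pred i | rk i == r]) => //; exists c.
have tw : tau w = 0.
  rewrite /w raddf_sum big_seq_cond big1 // => i /andP[si _].
  by rewrite raddfMz tau_h // mul0rz.
rewrite -(subrK w x); apply: spannedD wh; apply: (IH r.+1); last 1 first.
- by rewrite raddfB /= tx tw subrr.
- by move: re; rewrite ltnS subnS prednK // subn_gt0.
rewrite xE (bigID (fun i => rk i == r)) /= addrAC; apply: spannedD; last first.
  exists b; apply: eq_bigl => i /=.
  by rewrite andbC eq_sym ltn_neqAle.
rewrite (eq_bigl (fun i => rk i == r)); last first.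
  by move=> i /=; case: eqP => [->|]; rewrite ?leqnn ?andbF.
rewrite -sumrB big_seq_cond; apply: spanned_sum => i /andP[si /eqP ri].
rewrite (bE i si ri) mulrzA -pmulrn -mulrzBl /h opprD addrA subrr add0r.
apply/spannedMz/spannedN/(spanned_sub _ (z_span si)) => l sl /=.
by rewrite ri.
Qed.

Theorem kernel_cyclic_sum : exists f : {additive cyclic_sum (map q' s) -> G},
  injective f /\ forall x, (exists y, f y = x) <-> tau x = 0.
Proof.
have [f [fI fim]] := cyclic_sum_injection us q'_gt0 hz h_indep.
exists f; split=> // x; rewrite fim; split.
  apply: (@spanned_ind _ _ _ _ _ (fun x => tau x = 0)) => [|y y' ty ty'|i si _].
    exact: raddf0.
    by rewrite raddfB /= ty ty' subrr.
  exact: tau_h.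
apply: (@elim_rank 0 (\max_(i <- s) rk i).+1) => //.
by move=> i si; rewrite ltnS; apply: leq_bigmax_seq.
Qed.

End Triangular.

(** * The filtration of [Z_n] by the images of the powers of [d] *)

Lemma dvdn_div_gcd x y a : (0 < x)%N ->
  (x %/ gcdn x y %| a)%N = (x %| a * y)%N.
Proof.
move=> x0; have g0 : (0 < gcdn x y)%N by rewrite gcdn_gt0 x0.
have ex := divnK (dvdn_gcdl x y); have ey := divnK (dvdn_gcdr x y).
have -> : (x %| a * y)%N
    = (x %/ gcdn x y * gcdn x y %| a * (y %/ gcdn x y) * gcdn x y)%N.
  by rewrite ex -mulnA ey.
rewrite dvdn_pmul2r // Gauss_dvdl //.
rewrite /coprime -(eqn_pmul2r g0) mul1n muln_gcdl.
by rewrite ex ey.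
Qed.

Section DSequence.
Variables (n : nat) (d : int) (k : nat).
Hypothesis (n0 : (0 < n)%N) (hd : (2 <= `|d|)%N) (hk : dseq_stop n d k).
Local Notation nn := (dseq_n n d).
Local Notation dd := (dseq_d n d).

Lemma dseq_gt0 j : (0 < nn j)%N.
Proof.
elim: j => //= i IH; rewrite divn_gt0 ?gcdn_gt0 ?IH //.
by rewrite dvdn_leq ?dvdn_gcdl.
Qed.

Lemma dseq_d_gt0 j : (0 < dd j)%N.
Proof. by rewrite gcdn_gt0 dseq_gt0. Qed.

Lemma dseq_mul j : (nn j = nn j.+1 * dd j)%N.
Proof. by rewrite /= divnK ?dvdn_gcdl. Qed.

(** The meaning of the d-sequence: n_j generates the kernel of multiplication by d^j on Z_n.
    Dividing by the gcd with d removes exactly what one more factor d absorbs. *)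
Lemma dseq_ker j a : ((nn j)%:Z %| a)%Z = (n%:Z %| a * d ^+ j)%Z.
Proof.
rewrite !dvdzE abszM abszX /=; elim: j `|a|%N => [|j IH] b.
  by rewrite muln1.
by rewrite dvdn_div_gcd ?dseq_gt0 // IH expnS mulnA.
Qed.

Lemma zc_ker j a : (zc n a *~ d ^+ j == 0) = ((nn j)%:Z %| a)%Z.
Proof. by rewrite zcMz zc_eq0 // dseq_ker. Qed.

Lemma dseq_stable j : (k <= j)%N -> nn j = nn k.
Proof.
move=> /subnK <-; elim: (j - k)%N => //= i ->.
by have [e _] := hk; move: e; rewrite /dseq_d => ->; rewrite divn1.
Qed.

Lemma dseq_coprime : coprime (nn k) `|d|.
Proof. by have [/eqP] := hk. Qed.

Lemma dseq_d_gt1 j : (j < k)%N -> (1 < dd j)%N.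
Proof.
move=> jk; have [_ /(_ j jk)/eqP e] := hk.
by rewrite ltn_neqAle eq_sym e dseq_d_gt0.
Qed.

Lemma dseq_dvd i j : (i <= j)%N -> (nn j %| nn i)%N.
Proof.
move=> /subnK <-; elim: (j - i)%N => // e IH.
by apply: dvdn_trans IH; rewrite [nn (e + i)]dseq_mul addSn dvdn_mulr.
Qed.

Lemma bezout_stop a : exists b, ((nn k)%:Z %| a - d * b)%Z.
Proof.
have : coprimez (nn k) d by rewrite coprimezE /= dseq_coprime.
move=> /coprimezP[[u v] /= e]; exists (v * a).
have -> : a - d * (v * a) = (u * nn k) * a.
  by rewrite -[X in X - _]mul1r -e; ring.
by rewrite -mulrA mulrCA dvdz_mulr.
Qed.

Local Notation V := (Zmod n).

Definition imd (j : nat) (x : V) : bool := [exists y : V, x == y *~ d ^+ j].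

Lemma imdP j x : reflect (exists y, x = y *~ d ^+ j) (imd j x).
Proof. by apply: (iffP existsP) => [[y /eqP ->]|[y ->]]; exists y. Qed.

Lemma imd0 x : imd 0 x.
Proof. by apply/imdP; exists x; rewrite mulr1z. Qed.

Lemma imd_exp j y : imd j (y *~ d ^+ j).
Proof. by apply/imdP; exists y. Qed.

Lemma imd_mul j x : imd j x -> imd j.+1 (x *~ d).
Proof. by move/imdP=> [y ->]; apply/imdP; exists y; rewrite -mulrzA -exprSr. Qed.

Lemma imd_mulX i j x : imd j x -> imd (j + i) (x *~ d ^+ i).
Proof.
move=> jx; elim: i => [|i IH]; first by rewrite addn0 mulr1z.
by rewrite addnS exprSr mulrzA; apply: imd_mul.
Qed.

Lemma imdW i j x : (i <= j)%N -> imd j x -> imd i x.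
Proof.
move=> ij /imdP[y ->]; apply/imdP; exists (y *~ d ^+ (j - i)).
by rewrite -mulrzA -exprD subnK.
Qed.

(** The filtration is stationary from [k] on, since [d] is invertible modulo n_k and a
    representative matters only modulo n_k after multiplication by d^j. *)
Lemma imd_stable j x : imd k x -> imd j x.
Proof.
case: (leqP j k) => [|/ltnW kj]; first exact: imdW.
move: kj => /subnK <-; elim: (j - k)%N x => // i IH x /IH/imdP[y ->] {x}.
have [b kb] := bezout_stop (y : nat)%:Z; apply/imdP; exists (zc n b).
apply/eqP; rewrite -{1}(zc_val y) addSn exprS -subr_eq0 !zcMz -zcB mulrA -mulrBl.
rewrite zc_eq0 // -dseq_ker dseq_stable ?leq_addl //.
by rewrite [b * d]mulrC.
Qed.

Lemma imd_inj x : imd k x -> x *~ d = 0 -> x = 0.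
Proof.
move=> /imdP[y ->]; rewrite -(zc_val y) -mulrzA -exprSr => /eqP.
rewrite zc_ker (dseq_stable (leqnSn k)) => kv; apply/eqP.
by rewrite zc_ker.
Qed.

Lemma imdB j x y : imd j x -> imd j y -> imd j (x - y).
Proof.
move=> /imdP[x' ->] /imdP[y' ->]; apply/imdP; exists (x' - y').
by rewrite mulrzBl.
Qed.

Lemma imd_inj2 x y : imd k x -> imd k y -> x *~ d = y *~ d -> x = y.
Proof.
move=> kx ky e; apply/eqP; rewrite -subr_eq0; apply/eqP/imd_inj.
  exact: imdB.
by rewrite mulrzBl e subrr.
Qed.

(** The image of d^j is Z_n modulo the kernel of d^j, so the integers below n_j parametrize it. *)
Lemma card_imd j : #|[set x | imd j x]| = nn j.
Proof.
pose F (a : 'I_(nn j)) : V := zc n (a : nat)%:Z *~ d ^+ j.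
have FI : injective F.
  move=> a b /eqP; rewrite -subr_eq0 -mulrzBl -zcB zc_ker.
  rewrite -(zc_eq _ _ (dseq_gt0 j)) => /eqP/(congr1 val).
  rewrite !zc_nat /= prednK ?dseq_gt0 // !modn_small // => ab.
  exact: val_inj.
rewrite -[RHS]card_ord -(card_imset _ FI); apply: eq_card => x.
rewrite inE; apply/imdP/imsetP => [[y ->]|[a _ ->]]; last first.
  by exists (zc n (a : nat)%:Z).
have ly : ((y : nat) %% nn j < nn j)%N by rewrite ltn_mod dseq_gt0.
exists (Ordinal ly) => //; apply/eqP; rewrite /F /= -subr_eq0 -{1}(zc_val y).
rewrite -mulrzBl -zcB zc_ker {1}(divn_eq y (nn j)) PoszD addrK PoszM.
exact: dvdz_mull.
Qed.

(* A section of multiplication by [d] that picks a preimage as deep as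
   possible in the filtration by the images of the powers of [d]. *)
Lemma deep_section : exists c : V -> V, forall w j, imd j.+1 w ->
  c w *~ d = w /\ imd j (c w).
Proof.
suff /choice[c cP] : forall w, exists y : V, forall j, imd j.+1 w ->
    y *~ d = w /\ imd j y by exists c.
move=> w; have [kw|kw] := boolP (imd k w).
  have /imdP[y wE] := imd_stable k.+1 kw.
  exists (y *~ d ^+ k) => j _; rewrite wE -mulrzA -exprSr; split=> //.
  exact/imd_stable/imd_exp.
have [w1|w1] := boolP (imd 1 w); last first.
  by exists w => j /(@imdW 1)-/(_ isT); rewrite (negPf w1).
have ex : exists j, imd j.+1 w by exists 0%N.
have bd j : imd j.+1 w -> (j <= k)%N.
  by move=> jw; rewrite leqNgt; apply: contra kw => kj; apply/imdW/jw/ltnW/ltnW.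
case: (ex_maxnP ex bd) => J /imdP[y wE] mx.
exists (y *~ d ^+ J) => j jw; rewrite wE -mulrzA -exprSr; split=> //.
exact/(imdW (mx _ jw))/imd_exp.
Qed.

Section DeepSection.
Variable c : V -> V.
Hypothesis cP : forall w j, imd j.+1 w -> c w *~ d = w /\ imd j (c w).

Lemma iter_c_imd i j w : imd (j + i) w -> imd j (iter i c w).
Proof.
elim: i j w => [|i IH] j w; first by rewrite addn0.
by rewrite iterSr addnS => /cP[_] /IH.
Qed.

Lemma iter_c_mul i j w : imd (i + j) w -> iter (i + j) c w *~ d ^+ j = iter i c w.
Proof.
elim: j => [|j IH] jw; first by rewrite addn0 mulr1z.
rewrite addnS iterS exprS mulrzA.
have -> : c (iter (i + j) c w) *~ d = iter (i + j) c w.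
  have /cP[->] // : imd 1 (iter (i + j) c w).
  by apply: iter_c_imd; rewrite add1n -addnS.
by apply: IH; apply: imdW jw; rewrite addnS.
Qed.

Lemma iter_c_mul0 j w : imd j w -> iter j c w *~ d ^+ j = w.
Proof. exact: (@iter_c_mul 0). Qed.

Definition chain_end (i : nat) : {set V} :=
  [set u | [&& imd i u, ~~ imd i.+1 u & u != c (u *~ d)]].

Lemma chain_endP i u : reflect [/\ imd i u, ~~ imd i.+1 u & u <> c (u *~ d)]
  (u \in chain_end i).
Proof.
by rewrite inE; apply: (iffP and3P) => -[? ? /eqP].
Qed.

Lemma chain_end_depth i i' u : u \in chain_end i -> u \in chain_end i' -> i = i'.
Proof.
move=> /chain_endP[iu iu' _] /chain_endP[ju ju' _].
case: (ltngtP i i') => // l; first by case/negP: iu'; apply: imdW ju.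
by case/negP: ju'; apply: imdW iu.
Qed.

(** There are n_i - n_(i+1) points of exact depth [i]. Those excluded are the values of [c] on
    points of exact depth [i + 1], where [c] is injective, hence n_(i+1) - n_(i+2) of them. *)
Lemma card_chain_end i : #|chain_end i| = dseq_exp n d i.
Proof.
pose A := [set u | imd i u]; pose A1 := [set u | imd i.+1 u].
pose A2 := [set u | imd i.+2 u].
pose C := c @: (A1 :\: A2).
have A10 : A1 \subset A by apply/subsetP => u; rewrite !inE; apply: imdW.
have A21 : A2 \subset A1 by apply/subsetP => u; rewrite !inE; apply: imdW.
have BC : chain_end i = (A :\: A1) :\: C.
  apply/setP => u; apply/chain_endP/idP => [[u1 u2 u3]|].
    rewrite in_setD in_setD !in_set u1 u2 /= andbT; apply/imsetP => -[w].
    rewrite !inE => /andP[_ /cP[e _]] uE; apply: u3.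
    by rewrite {2}uE e.
  rewrite in_setD in_setD !in_set => /andP[uC /andP[u2 u1]]; split=> // e.
  move/negP: uC; apply; apply/imsetP; exists (u *~ d) => //.
  rewrite !inE (imd_mul u1) andbT; apply: contra u2 => /cP[_].
  by rewrite -e.
have CA : C \subset A :\: A1.
  apply/subsetP => u /imsetP[w]; rewrite !inE => /andP[w2 w1] ->.
  have [e ->] := cP w1; rewrite andbT; apply: contra w2 => /imd_mul.
  by rewrite e.
have cI : {in A1 :\: A2 &, injective c}.
  move=> w w'; rewrite !inE => /andP[_ /cP[e _]] /andP[_ /cP[e' _]] ee.
  by rewrite -e ee e'.
have cD (S S' : {set V}) : S' \subset S -> #|S :\: S'| = (#|S| - #|S'|)%N.
  by move=> /setIidPr ss; rewrite cardsD ss.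
rewrite BC !cD // card_in_imset // cD // !card_imd /dseq_exp.
have := dseq_mul i; have := dseq_mul i.+1.
have := dseq_d_gt0 i; have := dseq_d_gt0 i.+1.
clear; nia.
Qed.

End DeepSection.
End DSequence.

(** * Generators of the sand dune group and their dual functionals *)

Section Orbit.
Variables (m : nat) (d : int).
Hypothesis (m0 : (0 < m)%N) (md : coprime m `|d|).
Local Notation W := (Zmod m).
Implicit Types v w : W.

Lemma mul_coprime_inj v w j : v *~ d ^+ j = w *~ d ^+ j -> v = w.
Proof.
move=> /eqP; rewrite -subr_eq0 -mulrzBl => /eqP e.
apply/eqP; rewrite -subr_eq0; apply/eqP; move: e.
rewrite -[v - w]zc_val zcMz => /eqP; rewrite zc_eq0 // dvdzE abszM abszX.
rewrite Gauss_dvdl ?coprimeXr // => e.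
by apply/eqP; rewrite zc_eq0 // dvdzE.
Qed.

Let f v : W := v *~ d.

Let fI : injective f.
Proof. by move=> v w; apply: (@mul_coprime_inj _ _ 1). Qed.

Let iterE j v : iter j f v = v *~ d ^+ j.
Proof.
elim: j => [|j IH]; first by rewrite mulr1z.
by rewrite iterS IH /f -mulrzA -exprSr.
Qed.

Let orderE v : #|dorbit d v| = order f v.
Proof. by rewrite /dorbit cardsE. Qed.

Lemma dorbit_gt0 v : (0 < #|dorbit d v|)%N.
Proof. by rewrite orderE order_gt0. Qed.

Lemma dorbit_period v : v *~ d ^+ #|dorbit d v| = v.
Proof. by rewrite orderE -iterE iter_order. Qed.

Lemma dorbit_inj v i j : (i < #|dorbit d v|)%N -> (j < #|dorbit d v|)%N ->
  v *~ d ^+ i = v *~ d ^+ j -> i = j.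
Proof.
rewrite orderE => io jo; rewrite -!iterE => e.
by rewrite -(findex_iter io) e findex_iter.
Qed.

Lemma dorbit_dvd v j : v *~ d ^+ j = v -> (#|dorbit d v| %| j)%N.
Proof.
set o := #|_| => e; have o0 : (0 < o)%N := dorbit_gt0 v.
have per i : v *~ d ^+ (i * o) = v.
  elim: i => [|i IH]; first by rewrite mulr1z.
  by rewrite mulSn addnC exprD mulrzA IH dorbit_period.
have: v *~ d ^+ (j %% o) = v *~ d ^+ 0.
  rewrite mulr1z -[RHS]e {2}(divn_eq j o) exprD mulrzA.
  by rewrite per.
by move/dorbit_inj; rewrite /dvdn => -> //; rewrite ltn_mod.
Qed.

Lemma dorbitP v w : reflect (exists j, w = v *~ d ^+ j) (w \in dorbit d v).
Proof.
rewrite inE; apply: (iffP idP) => [vw|[j ->]].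
  by exists (findex f v w); rewrite -iterE iter_findex.
by rewrite -iterE fconnect_iter.
Qed.

Lemma dorbit_exp_gt0 v : (2 <= `|d|)%N -> (0 < `|(d ^+ #|dorbit d v| - 1)%R|)%N.
Proof.
move=> d2; rewrite absz_gt0 subr_eq0.
apply/eqP => /(congr1 absz); rewrite abszX /= => e.
have := dorbit_gt0 v; case: (#|_|) e => // o.
by rewrite expnS => /eqP; rewrite muln_eq1 => /andP[/eqP e]; rewrite e in d2.
Qed.

Section Representatives.
Variable X : {set W}.
Hypothesis hX : orbit_representatives d X.

Lemma rep_neq0 v : v \in X -> v != 0.
Proof. by case: hX => /and3P[_ /subsetP XD _] _ /XD; rewrite !inE. Qed.

Lemma rep_cover v : v != 0 -> exists2 x, x \in X & exists j, v = x *~ d ^+ j.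
Proof.
move=> v0; case: hX => /and3P[_ _ /forall_inP XB] _.
have /XB/cards1P[x xE] : dorbit d v \in [set dorbit d v | v in [set~ 0]].
  by apply: imset_f; rewrite !inE.
have : x \in X :&: dorbit d v by rewrite xE inE.
rewrite inE => /andP[xX xv]; exists x => //.
apply/dorbitP; move: xv; rewrite !inE.
by rewrite (fconnect_sym fI).
Qed.

Lemma rep_uniq x y j : x \in X -> y \in X -> y = x *~ d ^+ j -> x = y.
Proof.
move=> xX yX e; case: hX => /and3P[_ _ /forall_inP XB] _.
have /XB/cards1P[z zE] : dorbit d x \in [set dorbit d v | v in [set~ 0]].
  by apply: imset_f; rewrite !inE rep_neq0.
have : x \in X :&: dorbit d x.
  by rewrite inE xX; apply/dorbitP; exists 0%N; rewrite mulr1z.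
have : y \in X :&: dorbit d x by rewrite inE yX; apply/dorbitP; exists j.
by rewrite zE !inE => /eqP -> /eqP ->.
Qed.

End Representatives.
End Orbit.

Section Generators.
Variables (n : nat) (d : int) (k : nat).
Hypothesis (n0 : (0 < n)%N) (hd : (2 <= `|d|)%N) (hk : dseq_stop n d k).
Local Notation nn := (dseq_n n d).
Local Notation V := (Zmod n).
Local Notation m := (dseq_n n d k).
Local Notation W := (Zmod m).
Local Notation imd := (imd d).

Variable c : V -> V.
Hypothesis cP : forall w j, imd j.+1 w -> c w *~ d = w /\ imd j (c w).
Local Notation chain_end := (chain_end d c).

(** [G] stands for the sand dune group and [E x] for the class of e_x. The basis is built from four
    properties alone: the two kinds of relations, the universal property for cyclic targets, and
    generation. *)
Variables (G : zmodType) (E : V -> G).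
Hypothesis E0 : E 0 = 0.
Hypothesis Ed : forall x, E x *~ d = E (x *~ d).
Hypothesis Eadd : forall q (phi : V -> Zmod q), (0 < q)%N -> phi 0 = 0 ->
  (forall x, phi x *~ d = phi (x *~ d)) ->
  exists lam : {additive G -> Zmod q}, forall x, lam (E x) = phi x.
Hypothesis Egen : forall P : G -> Prop, P 0 ->
  (forall x y, P x -> P y -> P (x - y)) -> (forall x, P (E x)) -> forall x, P x.

Let m0 : (0 < m)%N := dseq_gt0 d n0 k.
Let md : coprime m `|d| := dseq_coprime hk.

Lemma EdX j x : E x *~ d ^+ j = E (x *~ d ^+ j).
Proof.
elim: j x => [|j IH] x; first by rewrite !mulr1z.
by rewrite exprS !mulrzA Ed IH.
Qed.

Definition chain_gen (i : nat) (u : V) : G :=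
  E (iter i c u) - E (iter i.+1 c (u *~ d)).

Lemma chain_gen_order i u : u \in chain_end i ->
  chain_gen i u *~ d ^+ i.+1 = 0.
Proof.
move=> /chain_endP[iu _ _]; rewrite mulrzBl !EdX.
rewrite (iter_c_mul0 cP (imd_mul iu)) exprSr mulrzA (iter_c_mul0 cP iu).
by rewrite subrr.
Qed.

Lemma not_chosen i u w r : u \in chain_end i -> imd r.+1 w ->
  iter r.+1 c w != u.
Proof.
move=> /chain_endP[_ _ un] rw; apply/eqP => e; apply: un.
have /cP[cy _] : imd 1 (iter r c w) by apply: iter_c_imd; rewrite ?add1n.
by rewrite -{2}e /= cy.
Qed.

(** The two points of a chain generator are followed under multiplication by [d]. Before step [i']
    both are values of [c], hence not the chain end [u]. At step [i'] the first is [u'] and the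
    second still a value of [c]. Afterwards they coincide. *)
Lemma chain_term i u i' u' j : u \in chain_end i -> u' \in chain_end i' ->
  (iter i' c u' *~ d ^+ j == u)%:Z - (iter i'.+1 c (u' *~ d) *~ d ^+ j == u)%:Z
  = ((j == i') && (u' == u))%:Z.
Proof.
move=> uB u'B; have /chain_endP[iu _ _] := u'B.
have e1 : iter i' c u' *~ d ^+ i' = u' := iter_c_mul0 cP iu.
have e2 : iter i'.+1 c (u' *~ d) *~ d ^+ i'.+1 = u' *~ d.
  exact/(iter_c_mul0 cP)/imd_mul.
have ne (r : nat) : (r <= i')%N ->
    (iter i'.+1 c (u' *~ d) *~ d ^+ r == u) = false.
  move=> ri; have -> : i'.+1 = ((i' - r).+1 + r)%N by rewrite addSn subnK.
  rewrite (iter_c_mul cP); last by rewrite addSn subnK ?imd_mul.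
  apply/negbTE/(not_chosen uB); apply: (imdW _ (imd_mul iu)).
  by rewrite ltnS leq_subr.
case: (ltngtP j i') => [ji|ij|->].
- rewrite (ne j (ltnW ji)) subr0.
  have -> : i' = ((i' - j.+1).+1 + j)%N by rewrite addSnnS subnK.
  rewrite (iter_c_mul cP); last by rewrite addSnnS subnK.
  rewrite (negbTE (not_chosen uB _)) //; apply: imdW iu.
  by lia.
- have -> : j = (i'.+1 + (j - i'.+1))%N by rewrite subnKC.
  by rewrite exprD !mulrzA e2 exprSr mulrzA e1 subrr.
- by rewrite ne // e1 subr0.
Qed.

(** The functional gives a point that reaches [u] after [j] steps the value d^(i-j), and 0 to all
    others. As [u] has depth exactly [i], no point needs more than [i] steps, and [u] itself gets
    d^i, whose multiple by [d] vanishes modulo d^(i+1). Periodic points never reach [u] because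
    [i < k]. *)
Lemma chain_dual i u : (i < k)%N -> u \in chain_end i ->
  exists2 lam : {additive G -> Zmod (`|d| ^ i.+1)},
    forall i' u', u' \in chain_end i' ->
      lam (chain_gen i' u') = zc _ ((i', u') == (i, u))%:Z &
    forall x, imd k x -> lam (E x) = 0.
Proof.
move=> ik uB; have /chain_endP[iu iu' _] := uB.
pose q := (`|d| ^ i.+1)%N.
have q0 : (0 < q)%N by rewrite expn_gt0; case: `|d|%N hd.
pose ph (x : V) : int := \sum_(j < i.+1) (x *~ d ^+ j == u)%:Z * d ^+ (i - j).
have nper x j : imd k x -> (x *~ d ^+ j == u) = false.
  move=> kx; apply: contraNF iu' => /eqP <-; apply: (imd_stable n0 hk).
  by apply: (imdW _ (imd_mulX j kx)); rewrite leq_addr.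
have ph0 x : imd k x -> ph x = 0.
  by move=> kx; rewrite /ph big1 // => j _; rewrite nper ?mul0r.
have k0 : imd k (0 : V) by apply/imdP; exists 0; rewrite mul0rz.
have phd x : zc q (ph x) *~ d = zc q (ph (x *~ d)).
  (* Both sides of the compatibility are sums over [t], shifted by one. Their difference telescopes
     to [t 0], a multiple of d^(i+1), and [t i.+1], which is 0 as [u] is not in the image of
     d^(i+1). *)
  pose t (j : nat) : int := (x *~ d ^+ j == u)%:Z * d ^+ (i.+1 - j).
  have t0 : t i.+1 = 0.
    rewrite /t; case: eqP => [e|_]; last by rewrite mul0r.
    by move: iu'; rewrite -e imd_exp.
  have p1 : ph x * d = \sum_(j < i.+1) t j.
    rewrite mulr_suml; apply: eq_bigr => j _; rewrite -mulrA -exprSr /t.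
    by rewrite subSn // -ltnS.
  have p2 : ph (x *~ d) = \sum_(j < i.+1) t j.+1.
    apply: eq_bigr => j _; rewrite /t subSS.
    by rewrite -mulrzA -exprS.
  rewrite zcMz; apply/eqP; rewrite zc_eq // p1 p2.
  rewrite -opprB -sumrB -(big_mkord xpredT (fun j => t j.+1 - t j)).
  rewrite telescope_sumr // t0 sub0r opprK /t.
  by rewrite dvdz_mull // dvdzE abszX subn0.
have [lam lamE] := @Eadd q (fun x => zc q (ph x)) q0 (congr1 (zc q) (ph0 0 k0)) phd.
exists lam => [i' u' u'B|x kx]; last by rewrite lamE ph0 // zc0.
rewrite raddfB /= !lamE -zcB; congr zc.
rewrite /ph -sumrB.
under eq_bigr => j _ do rewrite -mulrBl -iterS (chain_term j uB u'B).
have [ee|ne] := eqVneq u' u.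
  have ii : i' = i by move: u'B; rewrite ee => /chain_end_depth; apply.
  rewrite ii ee (bigD1 ord_max) //= !eqxx subnn mul1r big1 // => j.
  by rewrite -val_eqE /= => /negbTE ->; rewrite mul0r.
by rewrite big1 => [|j _]; rewrite ?andbF ?mul0r // xpair_eqE (negbTE ne) andbF.
Qed.

(** The identification of Z_m with the periodic part d^k Z_n. Multiplication by d^k is well defined
    on Z_m because m = n_k generates its kernel, and it commutes with multiplication by [d]. *)
Definition per_incl (v : W) : V := zc n (v : nat)%:Z *~ d ^+ k.

Lemma per_incl_zc a : per_incl (zc m a) = zc n a *~ d ^+ k.
Proof.
apply/eqP; rewrite -subr_eq0 -mulrzBl -zcB zc_ker //.
by rewrite -zc_eq // zc_val.
Qed.

Lemma per_inclM v b : per_incl (v *~ b) = per_incl v *~ b.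
Proof.
by rewrite -{1}(zc_val v) zcMz per_incl_zc /per_incl !zcMz mulrAC.
Qed.

Lemma per_incl_imd v : imd k (per_incl v).
Proof. exact: imd_exp. Qed.

Lemma imd_per_incl x : imd k x -> exists v, x = per_incl v.
Proof.
by move=> /imdP[y ->]; exists (zc m (y : nat)%:Z); rewrite per_incl_zc zc_val.
Qed.

Lemma per_incl0 : per_incl 0 = 0.
Proof. by rewrite /per_incl zc0 mul0rz. Qed.

Let mn : (m%:Z %| n%:Z)%Z.
Proof. by rewrite dvdzE; apply: (dseq_dvd n d (leq0n k)). Qed.

Let pr (x : V) : W := zc m (x : nat)%:Z.

Let pr_zc a : pr (zc n a) = zc m a.
Proof.
apply/eqP; rewrite zc_eq //; apply: dvdz_trans mn _.
by rewrite -zc_eq // zc_val.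
Qed.

Let prM x b : pr (x *~ b) = pr x *~ b.
Proof. by rewrite -{1}(zc_val x) zcMz pr_zc zcMz. Qed.

Lemma per_gen_order v : E (per_incl v) *~ (d ^+ #|dorbit d v| - 1) = 0.
Proof. by rewrite mulrzBr EdX -per_inclM dorbit_period // mulr1z subrr. Qed.

Section Periodic.
Variable X : {set W}.
Hypothesis hX : orbit_representatives d X.

(** The j-th point of the cycle of [v] gets the value d^j, which closes up modulo d^o - 1. The
    exponent [k + j] appears because [pr] after [per_incl] is multiplication by d^k. A chain
    generator is killed because its two points agree after d^(i+1), hence already modulo [m], where
    [d] is invertible. *)
Lemma per_dual v : v \in X ->
  exists2 lam : {additive G -> Zmod `|(d ^+ #|dorbit d v| - 1)%R|},
    {in X, forall w, lam (E (per_incl w)) = zc _ (w == v)%:Z} &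
    forall i u, u \in chain_end i -> lam (chain_gen i u) = 0.
Proof.
move=> vX; set o := #|_|; set q := `|_|%N.
have q0 : (0 < q)%N by apply: dorbit_exp_gt0.
pose ph (x : V) : int := \sum_(j < o) (pr x == v *~ d ^+ (k + j))%:Z * d ^+ j.
have phd x : zc q (ph x) *~ d = zc q (ph (x *~ d)).
  pose t (j : nat) : int := (pr x *~ d == v *~ d ^+ (k + j))%:Z * d ^+ j.
  have p1 : ph x * d = \sum_(j < o) t j.+1.
    rewrite mulr_suml; apply: eq_bigr => j _; rewrite -mulrA -exprSr /t.
    congr (_%:Z * _); rewrite addnS [d ^+ (k + j).+1]exprSr mulrzA.
    by congr nat_of_bool; apply/eqP/eqP => [->//|/(@mul_coprime_inj _ _ m0 md _ _ 1)].
  have p2 : ph (x *~ d) = \sum_(j < o) t j.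
    by apply: eq_bigr => j _; rewrite prM.
  rewrite zcMz; apply/eqP; rewrite zc_eq // p1 p2 -sumrB.
  rewrite -(big_mkord xpredT (fun j => t j.+1 - t j)) telescope_sumr // /t.
  rewrite addnC exprD mulrzA dorbit_period // addn0 -mulrBr expr0.
  by rewrite dvdz_mull // dvdzE.
have ph0 : zc q (ph 0) = 0.
  rewrite /ph big1 ?zc0 // => j _; case: eqP => [e|_]; last by rewrite mul0r.
  have : v = 0.
    apply: (@mul_coprime_inj _ _ m0 md _ _ (k + j)); rewrite -e mul0rz.
    by rewrite -(zc0 n) pr_zc zc0.
  by move/eqP; rewrite (negPf (rep_neq0 hX vX)).
have [lam lamE] := @Eadd q (fun x => zc q (ph x)) q0 ph0 phd.
exists lam => [w wX|i u uB].
  rewrite lamE; congr zc; rewrite /ph.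
  have prw : pr (per_incl w) = w *~ d ^+ k.
    by rewrite /per_incl prM pr_zc zc_val.
  have o0 : (0 < o)%N by apply: dorbit_gt0.
  have T (j : 'I_o) : (pr (per_incl w) == v *~ d ^+ (k + j))
      = (w == v) && (j == Ordinal o0).
    rewrite prw addnC exprD mulrzA.
    apply/eqP/andP => [/(mul_coprime_inj m0 md) e|[/eqP -> /eqP ->]]; last first.
      by rewrite mulr1z.
    have vw := rep_uniq hX vX wX e; split; first by rewrite vw.
    rewrite -val_eqE /=; apply/eqP/(@dorbit_inj _ d v) => //.
    by rewrite mulr1z -e vw.
  under eq_bigr => j _ do rewrite T.
  case: (w == v) => /=; last by rewrite big1 // => j _; rewrite mul0r.
  rewrite (bigD1 (Ordinal o0)) //= mul1r big1 ?addr0 // => j /negbTE ->.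
  by rewrite mul0r.
rewrite raddfB /= !lamE -zcB /ph.
suff -> : pr (iter i c u) = pr (c (iter i c (u *~ d))) by rewrite subrr zc0.
have /chain_endP[iu _ _] := uB.
apply: (@mul_coprime_inj _ _ m0 md _ _ i.+1); rewrite -!prM -iterS.
by rewrite (iter_c_mul0 cP (imd_mul iu)) exprSr mulrzA (iter_c_mul0 cP iu).
Qed.

Lemma chain_generation (P : G -> Prop) : P 0 ->
  (forall x y, P x -> P y -> P (x - y)) ->
  (forall i u, (i < k)%N -> u \in chain_end i -> P (chain_gen i u)) ->
  {in X, forall v, P (E (per_incl v))} -> forall x, P x.
Proof.
move=> P0 PB Pt Pp; apply: Egen => //.
have PM y r := @closedMz _ P P0 PB y r.
have Pper x : imd k x -> P (E x).
  move=> /imd_per_incl[v ->]; have [->|v0] := eqVneq v 0.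
    by rewrite per_incl0 E0.
  have [w wX [j ->]] := rep_cover m0 md hX v0.
  by rewrite per_inclM -EdX; apply/PM/Pp.
(* The statement for all [c^j w] at once is what survives the step from [w d]
   to [w]: the generator ended by [w] compares [c^i w] with [c^(i+1) (w d)]. *)
suff H r w j : imd k (w *~ d ^+ r) -> imd j w -> P (E (iter j c w)).
  by move=> x; apply: (H k x 0%N); rewrite ?imd_exp ?imd0.
elim: r w j => [|r IH] w j.
  rewrite mulr1z => kw _; apply: Pper.
  by apply: (iter_c_imd cP); apply: (imd_stable n0 hk).
rewrite exprS mulrzA => kw jw; have [kw'|nkw] := boolP (imd k w).
  apply: Pper; by apply: (iter_c_imd cP); apply: (imd_stable n0 hk).
have [e|ne] := eqVneq w (c (w *~ d)).
  rewrite e -iterSr; apply: IH => //; exact: imd_mul.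
have ex : exists i, imd i w by exists 0%N; apply: imd0.
have bd i : imd i w -> (i <= k)%N.
  by move=> iw; rewrite leqNgt; apply: contra nkw => ki; apply: imdW (ltnW ki) iw.
case: (ex_maxnP ex bd) => i iw mx.
have ik : (i < k)%N.
  by rewrite ltn_neqAle (bd i iw) andbT; apply: contra nkw => /eqP <-.
have wB : w \in chain_end i.
  apply/chain_endP; split=> //; last exact/eqP.
  by apply/negP => /mx; rewrite ltnn.
have ji := mx _ jw.
(* With [i] the exact depth of [w], every c^j w is a multiple of c^i w by a power of [d], and c^i w
   is the point that occurs in a generator. *)
have -> : iter j c w = iter i c w *~ d ^+ (i - j).
  by rewrite -{1}(subnKC ji) (iter_c_mul cP) // subnKC.
rewrite -EdX; apply: PM.
rewrite -(subrK (E (iter i.+1 c (w *~ d))) (E (iter i c w))).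
by apply: (closedD P0 PB); [exact: Pt|apply: IH => //; exact: imd_mul].
Qed.

End Periodic.
End Generators.

(** * Lifting the exponent *)

Lemma expr1D_approx (t : int) N : exists w, (1 + t) ^+ N = 1 + N%:Z * t + t ^+ 2 * w.
Proof.
elim: N => [|N [w e]]; first by exists 0; rewrite expr0; ring.
by exists (N%:Z + w + t * w); rewrite exprS e intS; ring.
Qed.

Lemma sum_expr1D_approx (t : int) N : exists w,
  \sum_(i < N) (1 + t) ^+ i = N%:Z + t * ('C(N, 2))%:Z + t ^+ 2 * w.
Proof.
elim: N => [|N [w e]]; first by exists 0; rewrite big_ord0 bin_small //; ring.
have [w' e'] := expr1D_approx t N; exists (w + w').
by rewrite big_ord_recr /= e e' binS bin1 PoszD intS; ring.
Qed.

(** With t = y - 1, the quotient (y^p - 1)/t is p + t C(p,2) + t^2 w. For odd p both p | t and p |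
    C(p,2), so this is p times a number congruent to 1. For p = 2 it is y + 1, which is 2 modulo 4
    if 4 | y - 1. *)
Lemma lifting_the_exponent (p : nat) (y : int) : prime p -> (p%:Z %| y - 1)%Z ->
  (p != 2%N) || (4 %| y - 1)%Z ->
  exists2 r, ~~ (p%:Z %| r)%Z & y ^+ p - 1 = (y - 1) * p%:Z * r.
Proof.
move=> pp /dvdzP[z zE] h; have yE : y = 1 + z * p by rewrite -zE addrC subrK.
have nd1 a : ~~ (p%:Z %| 1 + p%:Z * a)%Z.
  rewrite rpredDr ?dvdz_mulr // dvdzE dvdn1.
  by apply: contraTneq pp => /= ->.
have [p2|p2] := eqVneq p 2%N.
  move: h nd1; rewrite p2 => /= /dvdzP[a aE] nd1; exists (1 + 2 * a); first exact: nd1.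
  have -> : y = 1 + a * 4 by rewrite -aE addrC subrK.
  by rewrite expr2; ring.
have [w e] := sum_expr1D_approx (z * p) p.
have /dvdnP[b bE] : (p %| 'C(p, 2))%N.
  by apply: prime_dvd_bin => //=; rewrite ltn_neqAle eq_sym p2 prime_gt1.
exists (1 + p%:Z * (z * b%:Z + z ^+ 2 * w)); first exact: nd1.
rewrite subrX1 -mulrA; congr (_ * _); rewrite yE e bE PoszM; ring.
Qed.

Lemma lifting_the_exponent_iter (p b : nat) (y : int) : prime p ->
  (p%:Z %| y - 1)%Z -> (p != 2%N) || (4 %| y - 1)%Z ->
  exists2 r, ~~ (p%:Z %| r)%Z & y ^+ (p ^ b) - 1 = (y - 1) * p%:Z ^+ b * r.
Proof.
move=> pp py h; elim: b => [|b [r rp e]].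
  by exists 1; rewrite ?expr1 ?expr0 ?mulr1 // dvdzE dvdn1; apply: contraTneq pp => /= ->.
have dv a : (a %| y - 1)%Z -> (a %| y ^+ (p ^ b) - 1)%Z.
  by move=> ay; rewrite e -mulrA dvdz_mulr.
have [||r' r'p e'] := @lifting_the_exponent p (y ^+ (p ^ b)) pp.
- exact: dv.
- by case/orP: h => [->//|/dv ->]; rewrite orbT.
exists (r * r'); first by rewrite dvdzE abszM Euclid_dvdM // negb_or -!dvdzE rp.
by rewrite expnSr exprM e' e exprSr; ring.
Qed.

(* With [A = d^(o') - 1], [o'] the orbit length of [m/p^a], the number [c] makes
   [c e_(m/p^a)] agree with [e_v] in the [p]-part of [tau] while being killed by
   the order of [e_v]. *)
Lemma order_correction (p a o : nat) (d v A : int) : prime p ->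
  (p%:Z ^+ a %| v * (d ^+ o - 1))%Z ->
  [|| p != 2%N, (4 %| d - 1)%Z, (a <= 1)%N | ~~ (2 ^+ a.-1 %| v)%Z] ->
  (forall J, (p%:Z ^+ a %| d ^+ J - 1)%Z -> (A %| d ^+ J - 1)%Z) ->
  exists2 c, (A %| c * (d ^+ o - 1))%Z & (p%:Z ^+ a %| c - v)%Z.
Proof.
move=> pp hv cond hA.
have p0 : p%:Z != 0 by case: p pp {hv cond hA}.
have pv0 j : p%:Z ^+ j != 0 by rewrite expf_neq0.
have [av|av] := boolP (p%:Z ^+ a %| v)%Z.
  by exists 0; rewrite ?mul0r ?dvdz0 // sub0r rpredN.
have ex : exists j, (p%:Z ^+ j %| v)%Z by exists 0%N; rewrite expr0 dvd1z.
have bd j : (p%:Z ^+ j %| v)%Z -> (j <= a)%N.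
  move=> jv; rewrite leqNgt; apply: contra av => /ltnW aj.
  exact/(dvdz_trans _ jv)/dvdz_exp2l.
case: (ex_maxnP ex bd) => b /dvdzP[v' vE] mx.
have ba : (b < a)%N.
  rewrite ltn_neqAle bd ?vE ?dvdz_mull // andbT.
  by apply: contra av => /eqP <-; rewrite vE dvdz_mull.
have v'p : ~~ (p%:Z %| v')%Z.
  apply/negP => /dvdzP[x xE]; have := mx b.+1.
  by rewrite vE xE -mulrA -exprS dvdz_mull // => /(_ isT); rewrite ltnn.
have cop j r : ~~ (p%:Z %| r)%Z -> coprimez (p%:Z ^+ j) r.
  move=> rp; rewrite coprimezE abszX coprimeXl // prime_coprime //.
have dab : (p%:Z ^+ (a - b) %| d ^+ o - 1)%Z.
  move: hv; rewrite vE -{1}(subnK (ltnW ba)) exprD mulrAC dvdz_mul2r //.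
  by rewrite Gauss_dvdzr // cop.
have p1 : (p%:Z %| d ^+ o - 1)%Z.
  by apply: dvdz_trans dab; apply: (@dvdz_exp2l p%:Z 1); rewrite subn_gt0.
have [r rp rE] : exists2 r, ~~ (p%:Z %| r)%Z &
    (d ^+ o) ^+ (p ^ b) - 1 = (d ^+ o - 1) * p%:Z ^+ b * r.
  have [b0|b0] := posnP b.
    rewrite b0; exists 1; first by rewrite dvdzE dvdn1; apply: contraTneq pp => /= ->.
    by rewrite expr1 expr0 !mulr1.
  apply: lifting_the_exponent_iter => //.
  (* Only p = 2 needs care. If 2^(a-1) does not divide [v], then a - b is at least 2 and [dab]
     yields 4 | d^o - 1; a <= 1 is impossible since 0 < b < a. *)
  case/or4P: cond => [->//|d4|a1|v2]; last first.
  - have [p2|//] := eqVneq p 2%N; apply/orP; right.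
    have b2 : (b < a.-1)%N.
      rewrite ltnNge; apply: contra v2 => ab; rewrite vE p2.
      by rewrite dvdz_mull // dvdz_exp2l.
    apply: dvdz_trans dab; rewrite p2 -[4]/(2%:Z ^+ 2) dvdz_exp2l //; clear -b2; lia.
  - by clear -a1 ba b0; lia.
  - apply/orP; right; apply: dvdz_trans d4 _.
    by rewrite subrX1 dvdz_mulr.
(* For J = o p^b the factors p^(a-b) of d^o - 1 and p^b combine to p^a, so [hA] applies. Thus p^b r
   is an admissible multiplier, and it equals [v] up to units modulo p^a. *)
have Ar : (A %| (d ^+ o - 1) * p%:Z ^+ b * r)%Z.
  rewrite -rE -exprM; apply: hA; rewrite exprM rE -{1}(subnK (ltnW ba)) exprD.
  by rewrite dvdz_mulr // dvdz_mul.
have /coprimezP[[x y] /= xy] := cop a r rp.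
(* Here [y] inverts [r] modulo p^a, so the witness is p^b v' = v modulo p^a. *)
exists (p%:Z ^+ b * r * (y * v')).
  have -> : p%:Z ^+ b * r * (y * v') * (d ^+ o - 1)
      = (d ^+ o - 1) * p%:Z ^+ b * r * (y * v') by ring.
  exact: dvdz_mulr.
have -> : p%:Z ^+ b * r * (y * v') - v = - (p%:Z ^+ a * (x * v)).
  have -> : p%:Z ^+ b * r * (y * v') = (y * r) * v by rewrite vE; ring.
  have -> : y * r = 1 - x * p%:Z ^+ a by rewrite -xy; ring.
  ring.
by rewrite rpredN dvdz_mulr.
Qed.

(** [P] describes an ideal of the integers. A prime dividing its generator would divide [m] and also
    m/m_p, which is prime to p. Stating this for a predicate lets solvability of an equation be
    proved one prime at a time. *)
Lemma cofactor_ideal (m : nat) (P : int -> Prop) : (0 < m)%N ->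
  (forall a b, P a -> P b -> P (a - b)) -> P m%:Z ->
  (forall p, prime p -> (p %| m)%N -> P (m %/ m`_p)%N%:Z) -> P 1.
Proof.
move=> m0 PB Pm Pp.
have P0 : P 0 by rewrite -(subrr m%:Z); apply: PB.
have PM a (b : int) : P a -> P (b * a).
  by move=> Pa; rewrite mulrC -mulrzz; apply: (closedMz P0 PB).
have ex : exists g : nat, (0 < g)%N && `[< P g%:Z >].
  by exists m; rewrite m0; apply/asboolP.
case: (ex_minnP ex) => g /andP[g0 /asboolP Pg] mn.
have dv a : P a -> (g%:Z %| a)%Z.
  move=> Pa; apply/dvdz_mod0P/eqP.
  have Pr : P (a %% g)%Z by rewrite /modz; apply: PB => //; apply: PM.
  have L0 : 0 <= (a %% g)%Z by rewrite modz_ge0 // -lt0n.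
  have L1 : (a %% g)%Z < g%:Z by rewrite ltz_pmod.
  move: Pr L0 L1; case: (a %% g)%Z => // -[//|r] Pr _ lt; have := mn r.+1.
  by rewrite (asboolT Pr) => /(_ isT); rewrite leqNgt -ltz_nat lt.
have [g1|g1] := eqVneq g 1%N; first by move: Pg; rewrite g1.
have gp : (1 < g)%N by case: g g1 g0 {Pg mn dv} => [|[]].
have pp := pdiv_prime gp; have pg := pdiv_dvd g.
have gm : (g %| m)%N by have := dv _ Pm; rewrite dvdzE.
have pm := dvdn_trans pg gm.
have := dv _ (Pp _ pp pm); rewrite dvdzE /= => /(dvdn_trans pg).
have e : m = (m`_(pdiv g)^' * m`_(pdiv g))%N by rewrite mulnC partnC.
rewrite {1}e mulnK ?part_gt0 //.
have := part_pnat (pdiv g)^' m; rewrite p'natE // => /negP//.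
Qed.

(** * The factor c(v) and the distinguished points of Z_m *)

Section CFactor.
Variables (m : nat) (d : int).
Hypothesis (m0 : (0 < m)%N) (md : coprime m `|d|).
Local Notation W := (Zmod m).

Definition exceptional : bool := (d == 3 %[mod 4])%Z && (4 %| m)%N.

(** Repeats the branches of [cfactor], so that a single case analysis, [cfactorP], determines factor
    and rank together. *)
Definition crank (v : W) : nat :=
  if [seq p : nat <- primes m | (nat_of_ord v == m %/ m`_p)%N
        && [|| p != 2%N, (d == 1 %[mod 4])%Z | ~~ (4 %| m)%N]] is p :: _
  then 1%N
  else if (nat_of_ord v == m %/ m`_2)%N && exceptional then 1%N
  else if (nat_of_ord v == m %/ 2)%N && exceptional then 2%N else 0%N.

Variant cfactor_spec (v : W) : nat -> nat -> Prop :=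
| CfactorPrime p of prime p & (p %| m)%N & nat_of_ord v = (m %/ m`_p)%N
    & [|| p != 2%N, (4 %| d - 1)%Z | ~~ (4 %| m)%N] : cfactor_spec v m`_p 1
| CfactorTwo of exceptional & nat_of_ord v = (m %/ m`_2)%N :
    cfactor_spec v (m`_2 %/ 2)%N 1
| CfactorHalf of exceptional & nat_of_ord v = (m %/ 2)%N : cfactor_spec v 2 2
| CfactorOne of (forall p, prime p -> (p %| m)%N -> nat_of_ord v <> (m %/ m`_p)%N)
    & (exceptional -> nat_of_ord v <> (m %/ 2)%N) : cfactor_spec v 1 0.

Lemma mod4E : (d == 1 %[mod 4])%Z = (4 %| d - 1)%Z.
Proof. by rewrite eqz_mod_dvd. Qed.

Lemma cfactorP v : cfactor_spec v (cfactor d v) (crank v).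
Proof.
rewrite /cfactor /crank; case E: [seq _ <- _ | _] => [|p r]; last first.
  have : p \in p :: r by rewrite inE eqxx.
  rewrite -E mem_filter mem_primes mod4E => /and3P[/andP[/eqP vE c] pp /andP[_ pm]].
  exact: CfactorPrime.
rewrite -/exceptional.
case: ifP => [/andP[/eqP v2 e]|H2]; first exact: CfactorTwo.
rewrite [(4 %| m)%N && _]andbC -/exceptional.
case: ifP => [/andP[/eqP v2 e]|H3]; first exact: CfactorHalf.
apply: CfactorOne => [p pp pm vE|e vE]; last by rewrite vE eqxx e in H3.
have : p \notin [seq p : nat <- primes m | (nat_of_ord v == m %/ m`_p)%N
        && [|| p != 2%N, (d == 1 %[mod 4])%Z | ~~ (4 %| m)%N]] by rewrite E.
rewrite mem_filter mem_primes pp m0 pm vE eqxx /= andbT !negb_or !negbK.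
(* A point m/m_p rejected by the filter has p = 2, 4 | m and d not 1 modulo 4. As [d] is odd, d = 3
   modulo 4, and the second branch would have caught it. *)
move=> /and3P[/eqP p2 d1 m4]; rewrite p2 in vE.
move: H2; rewrite vE eqxx /exceptional m4 /=.
have : ~~ (2 %| d)%Z.
  apply/negP => d2; have : (2 %| gcdn m `|d|)%N.
    by rewrite dvdn_gcd (dvdn_trans _ m4) //; move: d2; rewrite dvdzE.
  by rewrite (eqP md).
clear -d1; lia.
Qed.

Lemma part_div p : prime p -> (p %| m)%N -> ((m %/ m`_p) * m`_p = m)%N.
Proof. by move=> pp pm; rewrite divnK ?dvdn_part. Qed.

Lemma part_gt1 p : prime p -> (p %| m)%N -> (1 < m`_p)%N.
Proof.
move=> pp pm; rewrite p_part -(expn0 p) ltn_exp2l ?prime_gt1 //.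
by rewrite logn_gt0 mem_primes pp m0.
Qed.

Lemma cofactor_lt p : prime p -> (p %| m)%N -> (m %/ m`_p < m)%N.
Proof. by move=> pp pm; rewrite ltn_Pdiv ?part_gt1. Qed.

Lemma cofactor_coprime p : prime p -> coprime (m`_p) (m %/ m`_p).
Proof.
move=> pp; have {2}-> : m = (m`_p^' * m`_p)%N by rewrite mulnC partnC.
by rewrite mulnK ?part_gt0 // coprime_partC.
Qed.

Lemma part_dvd_cofactor p p' : prime p -> prime p' -> p != p' ->
  (m`_p %| m %/ m`_p')%N.
Proof.
move=> pp pp' ne; rewrite dvdn_divRL ?dvdn_part // -{3}(partnC p m0).
rewrite dvdn_pmul2l ?part_gt0 //.
rewrite -[(m`_p')%N](@part_pnat_id p^') ?partn_dvd ?dvdn_part //.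
apply: sub_in_pnat (part_pnat p' m) => x _; rewrite !inE => /eqP ->.
by rewrite eq_sym.
Qed.

End CFactor.

(** * The kernel of [tau] *)

Lemma PoszX (a b : nat) : (a ^ b)%N%:Z = a%:Z ^+ b.
Proof. by elim: b => // b IH; rewrite expnS PoszM IH exprS. Qed.

Section Assembly.
Variables (n : nat) (d : int) (k : nat).
Hypothesis (n0 : (0 < n)%N) (hd : (2 <= `|d|)%N) (hk : dseq_stop n d k).
Local Notation nn := (dseq_n n d).
Local Notation dd := (dseq_d n d).
Local Notation V := (Zmod n).
Local Notation m := (dseq_n n d k).
Local Notation W := (Zmod m).
Local Notation imd := (imd d).

Variable X : {set W}.
Hypothesis hX : orbit_representatives d X.

Variables (G : zmodType) (E : V -> G).
Hypothesis E0 : E 0 = 0.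
Hypothesis Ed : forall x, E x *~ d = E (x *~ d).
Hypothesis Eadd : forall q (phi : V -> Zmod q), (0 < q)%N -> phi 0 = 0 ->
  (forall x, phi x *~ d = phi (x *~ d)) ->
  exists lam : {additive G -> Zmod q}, forall x, lam (E x) = phi x.
Hypothesis Egen : forall P : G -> Prop, P 0 ->
  (forall x y, P x -> P y -> P (x - y)) -> (forall x, P (E x)) -> forall x, P x.

Variable c : V -> V.
Hypothesis cP : forall w j, imd j.+1 w -> c w *~ d = w /\ imd j (c w).
Local Notation chain_end := (chain_end d c).

Let m0 : (0 < m)%N := dseq_gt0 d n0 k.
Let md : coprime m `|d| := dseq_coprime hk.

(* Chains of length [i+1] on which [tau] takes a value generating
   [ker d^(i+1) / ker d^i]. *)
Lemma chain_end_jump i : (i < k)%N -> exists2 u, u \in chain_end i &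
  exists2 y : V, y *~ d ^+ i = 0 &
    iter i c u - iter i.+1 c (u *~ d) = zc n (nn i.+1) + y.
Proof.
(* [t] generates the kernel of d^(i+1) and is not killed by d^i. So [u] is the chosen preimage of
   [w] moved by t d^i, a different preimage of [w]. *)
move=> ik; pose w : V := zc n 1 *~ d ^+ i.+1; pose l := iter i.+1 c w.
pose t : V := zc n (nn i.+1); pose u := (l + t) *~ d ^+ i.
have wi : imd i.+1 w by apply: imd_exp.
have lE : l *~ d ^+ i.+1 = w by apply: (iter_c_mul0 cP).
have t0 : t *~ d ^+ i.+1 = 0 by apply/eqP; rewrite zc_ker.
have ud : u *~ d = w by rewrite /u -mulrzA -exprSr mulrzDl lE t0 addr0.
have cw : c w = l *~ d ^+ i.
  by rewrite /l -[i.+1]add1n (iter_c_mul cP).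
have td : t *~ d ^+ i != 0.
  rewrite zc_ker // dvdzE !absz_nat.
  have := dseq_d_gt1 n0 hk ik; have := dseq_gt0 d n0 i.+1.
  move=> a b; apply/negP => dv; have := dvdn_leq a dv.
  rewrite (dseq_mul n d i) leqNgt.
  by rewrite -{1}[nn i.+1]muln1 ltn_pmul2l // b.
have ne : u <> c (u *~ d).
  rewrite ud cw /u mulrzDl => /eqP; rewrite addrC -subr_eq0 addrK.
  exact/negP.
have iu : imd i u by apply: imd_exp.
have niu : ~~ imd i.+1 u.
  (* Suppose [u] were deeper. If i + 1 = k, then [u] and c(ud) are two periodic preimages of one
     point. Otherwise [w] has depth i + 2, and d_(i+1) > 1 would divide 1. *)
  apply/negP => iu1; move: ik; rewrite leq_eqVlt => /orP[/eqP ik|ik].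
    rewrite ik in iu1; apply: ne; apply: (imd_inj2 n0 hk) => //.
      by have /cP[] : imd k.+1 (u *~ d) by apply: imd_mul.
    by have /cP[-> _] := imd_mul iu.
  have := imd_mul iu1; rewrite ud => /imdP[y].
  rewrite /w -(zc_val y) [d ^+ i.+2]exprS mulrzA [_ *~ d]zcMz => /eqP.
  rewrite -subr_eq0 -mulrzBl -zcB zc_ker //.
  have d1 := dseq_d_gt1 n0 hk ik.
  have g1 : ((dd i.+1)%:Z %| (nn i.+1)%:Z)%Z by rewrite dvdzE dvdn_gcdl.
  have g2 : ((dd i.+1)%:Z %| d)%Z by rewrite dvdzE dvdn_gcdr.
  move/(dvdz_trans g1); rewrite rpredBr ?dvdz_mull // dvdzE dvdn1 /= => /eqP e.
  by rewrite e in d1.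
exists u; first exact/chain_endP.
exists (iter i c u - l - t); last by rewrite ud -/l [RHS]addrC subrK.
rewrite 2!mulrzBl (iter_c_mul0 cP iu) /u mulrzDl.
by rewrite [_ + t *~ _]addrC addrK subrr.
Qed.

Variable us : nat -> V.
Hypothesis usP : forall i, (i < k)%N -> us i \in chain_end i /\
  exists2 y : V, y *~ d ^+ i = 0 &
    iter i c (us i) - iter i.+1 c (us i *~ d) = zc n (nn i.+1) + y.

Definition dune_index : eqType := ((nat * V) + W)%type.

(** The distinguished chain is put first because its order comes first in each block of
    [S_orders]. *)
Definition chain_list i : seq V := us i :: rem (us i) (enum (chain_end i)).

Definition dune_indices : seq dune_index :=
  flatten [seq [seq inl (i, u) | u <- chain_list i] | i <- iota 0 k]
  ++ [seq inr v | v <- enum X].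

Definition dune_gens (l : dune_index) : G :=
  match l with
  | inl iu => chain_gen d c E iu.1 iu.2
  | inr v => E (per_incl v)
  end.

Definition dune_order (l : dune_index) : nat :=
  match l with
  | inl iu => (`|d| ^ iu.1.+1)%N
  | inr v => `|(d ^+ #|dorbit d v| - 1)%R|%N
  end.

Definition index_factor (l : dune_index) : nat :=
  match l with
  | inl iu => if iu.2 == us iu.1 then dd iu.1 else 1%N
  | inr v => cfactor d v
  end.

(* Longer chains are eliminated first.  If [d = 3 mod 4] and [4 | m], the
   generator at [m/2^a] is corrected by the one at [m/2], which therefore has the
   larger rank. *)
Definition dune_rank (l : dune_index) : nat :=
  match l with
  | inl iu => if iu.2 == us iu.1 then (k - iu.1)%N else 0%N
  | inr v => crank d v
  end.

Definition kernel_order (l : dune_index) : nat := (dune_order l %/ index_factor l)%N.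

Lemma chain_list_perm i : (i < k)%N -> perm_eq (chain_list i) (enum (chain_end i)).
Proof.
by move=> ik; rewrite perm_sym perm_to_rem // mem_enum; case: (usP ik).
Qed.

Lemma indices_inl i u :
  (inl (i, u) \in dune_indices) = (i < k)%N && (u \in chain_end i).
Proof.
rewrite mem_cat; have -> : (inl (i, u) \in [seq inr v | v <- enum X] : bool) = false.
  by apply/mapP => -[].
rewrite orbF; apply/flattenP/andP => [[r /mapP[j]]|[ik uB]].
  rewrite mem_iota leq0n add0n => jk -> /mapP[u' u'L [-> ->]]; split=> //.
  by rewrite -mem_enum -(perm_mem (chain_list_perm jk)).
exists [seq inl (i, u) | u <- chain_list i].
  by apply: map_f; rewrite mem_iota.
by apply: map_f; rewrite (perm_mem (chain_list_perm ik)) mem_enum.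
Qed.

Lemma indices_inr v : (inr v \in dune_indices) = (v \in X).
Proof.
rewrite mem_cat mem_map ?mem_enum; last by move=> a b [].
apply/orb_idl => /flattenP[r /mapP[j _ ->] /mapP[]] //.
Qed.

Lemma indices_uniq : uniq dune_indices.
Proof.
rewrite cat_uniq; apply/and3P; split.
- apply: (@allpairs_uniq_dep nat (fun=> V) dune_index (fun i u => inl (i, u))
    (iota 0 k) chain_list).
  - exact: iota_uniq.
  - move=> i; rewrite mem_iota add0n => /andP[_ ik].
    by rewrite (perm_uniq (chain_list_perm ik)) enum_uniq.
  - by move=> [i u] [j w] _ _ [-> ->].
- by apply/hasPn => l /mapP[v _ ->]; apply/flattenP => -[r /mapP[j _ ->] /mapP[]].
- by rewrite map_inj_uniq ?enum_uniq // => a b [].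
Qed.

Lemma map_order_of : map dune_order dune_indices = sigma_orders X.
Proof.
rewrite map_cat /sigma_orders -map_comp; congr (_ ++ _).
rewrite map_flatten -map_comp; congr flatten; apply/eq_in_map => i.
rewrite mem_iota add0n => /andP[_ ik].
rewrite -(card_chain_end n0 cP) cardE -(perm_size (chain_list_perm ik)).
rewrite /comp -map_comp.
by elim: (chain_list i) => //= x r ->.
Qed.

Lemma map_kernel_order : map kernel_order dune_indices = S_orders X.
Proof.
rewrite map_cat /S_orders -map_comp; congr (_ ++ _).
rewrite map_flatten -map_comp; congr flatten; apply/eq_in_map => i.
rewrite mem_iota add0n => /andP[_ ik] /=.
rewrite /kernel_order /= eqxx; congr (_ :: _); have [uB _] := usP ik.
rewrite -(card_chain_end n0 cP) cardE subn1 -(@size_rem _ (us i)) ?mem_enum //.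
have : us i \notin rem (us i) (enum (chain_end i)).
  by rewrite mem_rem_uniq ?enum_uniq // inE eqxx.
elim: (rem _ _) => //= x r IH; rewrite inE negb_or => /andP[ux /IH ->].
by rewrite eq_sym (negbTE ux) divn1.
Qed.

Lemma absz_ann (x : G) (a : int) : x *~ a = 0 -> x *+ `|a|%N = 0.
Proof. by move=> xa; rewrite pmulrn abszE normrEsign mulrC mulrzA xa mul0rz. Qed.

Lemma gens_order l : l \in dune_indices -> dune_gens l *+ dune_order l = 0.
Proof.
case: l => [[i u]|v]; rewrite ?indices_inl ?indices_inr => H.
  case/andP: H => _ uB; have := chain_gen_order cP Ed uB.
  by move/absz_ann; rewrite abszX.
by apply/absz_ann/per_gen_order.
Qed.

Lemma gens_dual : {in dune_indices, forall l,
  exists2 lam : {additive G -> Zmod (dune_order l)}, lam (dune_gens l) = zc _ 1 &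
  {in dune_indices, forall l', l' != l -> lam (dune_gens l') = 0}}.
Proof.
case=> [[i u]|v]; rewrite ?indices_inl ?indices_inr.
  case/andP=> ik uB; have [lam l1 l2] := chain_dual n0 hd hk cP Eadd ik uB.
  exists lam; first by rewrite l1 // eqxx.
  case=> [[i' u']|v]; rewrite ?indices_inl ?indices_inr.
    by case/andP=> ik' uB' ne; rewrite /= l1 // (negbTE (ne : (i', u') != (i, u))) zc0.
  by move=> vX _; rewrite /= l2 //; apply: per_incl_imd.
move=> vX; have [lam l1 l2] := per_dual n0 hd hk cP Eadd hX vX.
exists lam; first by rewrite /= l1 // eqxx.
case=> [[i' u']|w]; rewrite ?indices_inl ?indices_inr.
  by case/andP=> ik' uB' _; rewrite /= l2.
by move=> wX ne; rewrite /= l1 // (negbTE (ne : w != v)) zc0.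
Qed.

Lemma gens_generate x : spanned dune_gens dune_indices predT x.
Proof.
apply: (chain_generation n0 hk cP E0 Ed Egen hX).
- exact: spanned0.
- exact: spannedB.
- move=> i u ik uB.
  apply: (@spanned_gen _ _ dune_gens dune_indices predT (inl (i, u))) => //.
    exact: indices_uniq.
  by rewrite indices_inl ik.
- move=> v vX; apply: (@spanned_gen _ _ dune_gens dune_indices predT (inr v)) => //.
    exact: indices_uniq.
  by rewrite indices_inr.
Qed.

Lemma order_of_gt0 l : (0 < dune_order l)%N.
Proof.
case: l => [[i u]|v] /=; last by apply: dorbit_exp_gt0.
by rewrite expn_gt0; case: `|d|%N hd.
Qed.

Lemma dune_isog : zmod_isog G (cyclic_sum (sigma_orders X)).
Proof.
rewrite -map_order_of; apply: (@dual_basis_isog _ _ dune_indices dune_gens dune_order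
  dune_order (fun=> 1%N) indices_uniq).
- by move=> l _; apply: order_of_gt0.
- by [].
- by move=> l _; rewrite muln1.
- exact: gens_order.
- exact: gens_dual.
- exact: gens_generate.
Qed.

Variable tau : {additive G -> V}.
Hypothesis tauE : forall x, tau (E x) = x.

Lemma tau_chain i u : tau (chain_gen d c E i u) = iter i c u - iter i.+1 c (u *~ d).
Proof. by rewrite raddfB /= !tauE. Qed.

(** Values of [tau] in the kernel of d^i are attained on distinguished chains of length at most [i]:
    the value at [us i] generates the kernel of d^(i+1) modulo that of d^i, so one chain is peeled
    off per step. The solution is again killed by d^i. *)
Lemma tree_solve i (x : V) : (i <= k)%N -> x *~ d ^+ i = 0 -> exists y,
  [/\ spanned dune_gens dune_indices [pred l | k - i < dune_rank l]%N y,
      y *~ d ^+ i = 0 & tau y = x].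
Proof.
elim: i x => [|i IH] x ik xi.
  by exists 0; split; [exact: spanned0|rewrite mul0rz|rewrite raddf0 -[x]mulr1z xi].
have [uB [t ti tE]] := usP ik.
have := xi; rewrite -{1}(zc_val x) => /eqP; rewrite zc_ker // => /dvdzP[a aE].
have xE : x = zc n (nn i.+1) *~ a by rewrite zcMz mulrC -aE zc_val.
have [||y [ys yi yE]] := IH (- t *~ a); first exact: ltnW.
  by rewrite mulrzAC mulNrz ti oppr0 mul0rz.
exists (chain_gen d c E i (us i) *~ a + y); split.
- apply: spannedD; last first.
    by apply: spanned_sub ys => l _ /=; apply: leq_ltn_trans; rewrite leq_sub2l.
  apply: spannedMz; apply: (@spanned_gen _ _ dune_gens dune_indices _ (inl (i, us i))).
  - exact: indices_uniq.
  - by rewrite indices_inl ik.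
  - by rewrite /= eqxx; lia.
- rewrite mulrzDl [_ *~ a *~ _]mulrzAC (chain_gen_order cP Ed uB) mul0rz add0r.
  by rewrite exprSr mulrzA yi mul0rz.
- by rewrite raddfD raddfMz /= tau_chain tE yE xE mulrzDl mulNrz addrK.
Qed.

Let odd_d : (2 %| m)%N -> ~~ (2 %| d)%Z.
Proof.
move=> m2; apply/negP => d2; have : (2 %| gcdn m `|d|)%N.
  by rewrite dvdn_gcd m2; move: d2; rewrite dvdzE.
by rewrite (eqP md).
Qed.

Section Cofactor.
Variable p : nat.
Hypothesis (pp : prime p) (pm : (p %| m)%N).

Definition cofactor_point : W := zc m (m %/ m`_p)%N.

Lemma cofactor_val : cofactor_point = (m %/ m`_p)%N :> nat.
Proof. by rewrite /cofactor_point zc_nat /= prednK // modn_small ?cofactor_lt. Qed.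

Lemma cofactor_rep : cofactor_point \in X.
Proof.
have [_ /(_ p (logn p m) pp pm)] := hX; rewrite leqnn andbT logn_gt0 mem_primes.
by rewrite pp m0 pm => /(_ isT); rewrite /cofactor_point zc_nat p_part.
Qed.

Lemma cofactor_rank : (0 < crank d cofactor_point)%N.
Proof.
by case: (cfactorP m0 md cofactor_point) => // /(_ p pp pm); rewrite cofactor_val.
Qed.

Lemma cofactorM a b : ((m`_p)%N%:Z %| a - b)%Z ->
  cofactor_point *~ a = cofactor_point *~ b.
Proof.
move=> ab; apply/eqP; rewrite /cofactor_point !zcMz zc_eq // -mulrBr.
have -> : m%:Z = (m %/ m`_p)%N%:Z * (m`_p)%N%:Z by rewrite -PoszM part_div.
by rewrite dvdz_mul.
Qed.

Lemma cofactor_order_dvd J : ((m`_p)%N%:Z %| d ^+ J - 1)%Z ->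
  (d ^+ #|dorbit d cofactor_point| - 1 %| d ^+ J - 1)%Z.
Proof.
move=> /cofactorM; rewrite mulr1z => /(dorbit_dvd m0 md)/dvdnP[e ->].
by rewrite mulnC exprM subrX1 dvdz_mulr.
Qed.

End Cofactor.

Definition half_point : W := zc m (m %/ 2)%N.

Section Half.
Hypothesis m2 : (2 %| m)%N.

Lemma half_val : half_point = (m %/ 2)%N :> nat.
Proof. by rewrite /half_point zc_nat /= prednK // modn_small // ltn_Pdiv. Qed.

Lemma half_rep : half_point \in X.
Proof.
have [_ /(_ 2 1 isT m2)] := hX; rewrite /= logn_gt0 mem_primes m0 m2.
by move=> /(_ isT); rewrite /half_point zc_nat expn1.
Qed.


(** Since [d] is odd, m/2 is a fixed point of multiplication by [d]. *)
Lemma half_ann a : (d - 1 %| a)%Z -> E (per_incl half_point) *~ a = 0.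
Proof.
move=> /dvdzP[b ->]; rewrite mulrC mulrzA mulrzBr Ed -(per_inclM n0) mulr1z.
suff -> : half_point *~ d = half_point by rewrite subrr mul0rz.
apply/eqP; rewrite /half_point zcMz zc_eq // -[X in _ - X]mulr1 -mulrBr.
have /dvdzP[e ->] : (2 %| d - 1)%Z by have := odd_d m2; clear; lia.
by rewrite mulrCA -PoszM divnK // dvdz_mull.
Qed.

End Half.

Lemma exceptional_even : exceptional m d -> (2 %| m)%N.
Proof. by case/andP=> _ m4; apply: dvdn_trans m4. Qed.

Lemma exceptional_part : exceptional m d -> (4 %| m`_2)%N.
Proof.
case/andP=> _ m4; rewrite p_part -[4%N]/(2 ^ 2)%N dvdn_exp2l //.
by rewrite -pfactor_dvdn.
Qed.

Lemma half_part : exceptional m d -> (m %/ m`_2 * (m`_2 %/ 2) = m %/ 2)%N.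
Proof.
move=> e; have p2 : (2 %| m`_2)%N by apply: dvdn_trans (exceptional_part e).
by rewrite muln_divA // part_div ?exceptional_even.
Qed.

Lemma half_rank : exceptional m d -> crank d half_point = 2%N.
Proof.
move=> e; have m2 := exceptional_even e; have hv := half_val.
have E4 := exceptional_part e; have hp := half_part e.
have ne2 : (m %/ 2)%N <> (m %/ m`_2)%N.
  have h0 : (0 < m %/ 2)%N by rewrite divn_gt0 // dvdn_leq.
  move=> e2; have /eqP : (m %/ 2 * 2 = m %/ 2 * m`_2)%N.
    by rewrite [in RHS]e2 part_div // divnK.
  by rewrite (eqn_pmul2l h0) => /eqP e3; move: E4; rewrite -e3.
case: (cfactorP m0 md half_point) => // [p pp pm|_|_ /(_ e)]; rewrite hv => //.
move=> hE h; case: (eqVneq p 2%N) hE h => [->|p2 hE _]; first by [].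
have := part_dvd_cofactor m0 pp (isT : prime 2) p2.
have : (m %/ m`_2 %| m %/ 2)%N by rewrite -hp dvdn_mulr.
move=> /[swap] /dvdn_trans /[apply]; rewrite hE.
move=> dv; have := cofactor_coprime m0 pp; rewrite /coprime (gcdn_idPl dv).
by have := part_gt1 m0 pp pm; case: (m`_p)%N => [|[]].
Qed.

(** Supplies the correction for an ordinary [v]. The multiples of [v] that can be solved form an
    ideal, so by [cofactor_ideal] only v m/m_p has to be treated; there [order_correction] provides
    a multiple of the class at m/m_p. *)
Lemma per_solve (v : W) : exists y,
  [/\ spanned dune_gens dune_indices [pred l | 0 < dune_rank l]%N y,
      y *~ (d ^+ #|dorbit d v| - 1) = 0 & tau y = per_incl v].
Proof.
set N := d ^+ _ - 1.
pose P t := exists y, [/\ spanned dune_gens dune_indices [pred l | 0 < dune_rank l]%N y,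
  y *~ N = 0 & tau y = per_incl (v *~ t)].
suff [y [y1 y2 y3]] : P 1 by exists y; rewrite y3 mulr1z.
apply: (cofactor_ideal m0).
- move=> a b [y [y1 y2 y3]] [w [w1 w2 w3]]; exists (y - w); split.
  + exact: spannedB.
  + by rewrite mulrzBl y2 w2 subrr.
  + rewrite raddfB /= y3 w3 !(per_inclM n0) mulrzBr //.
- exists 0; split; [exact: spanned0|by rewrite mul0rz|].
  rewrite raddf0 -[v]zc_val zcMz; have -> : zc m ((v : nat)%:Z * m%:Z) = 0.
    by apply/eqP; rewrite zc_eq0 // dvdz_mull.
  by rewrite per_incl0.
move=> p pp pm.
have span_rep (w : W) : w \in X -> (0 < crank d w)%N -> forall a,
    spanned dune_gens dune_indices [pred l | 0 < dune_rank l]%N (E (per_incl w) *~ a).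
  move=> wX rw a; apply: spannedMz.
  apply: (@spanned_gen _ _ dune_gens dune_indices _ (inr w)) => //.
    exact: indices_uniq.
  by rewrite indices_inr.
pose a := logn p m; have aE : (m`_p)%N%:Z = p%:Z ^+ a by rewrite p_part PoszX.
have mv : (m%:Z %| (v : nat)%:Z * N)%Z.
  rewrite mulrBr mulr1 -zc_eq // -zcMz zc_val.
  by rewrite dorbit_period.
have [cond|ncond] := boolP [|| p != 2%N, (4 %| d - 1)%Z, (a <= 1)%N |
    ~~ (2 ^+ a.-1 %| (v : nat)%:Z)%Z].
  have := @order_correction p a #|dorbit d v| d (v : nat)%:Z
    (d ^+ #|dorbit d (cofactor_point p)| - 1) pp.
  rewrite -aE; case=> //.
  - apply: dvdz_trans mv; rewrite dvdzE; exact: dvdn_part.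
  - by move=> J; apply: cofactor_order_dvd.
  move=> e eA ev; exists (E (per_incl (cofactor_point p)) *~ e); split.
  + by apply: span_rep; [exact: cofactor_rep|exact: cofactor_rank].
  + move: eA => /dvdzP[b bE]; rewrite -mulrzA bE mulrC mulrzA per_gen_order //.
    by rewrite mul0rz.
  + rewrite raddfMz /= tauE -(per_inclM n0); congr per_incl.
    by rewrite (cofactorM pp pm ev) /cofactor_point zcMz mulrC -zcMz zc_val.
(* The remaining case is p = 2, d = 3 modulo 4, a >= 2 and 2^(a-1) | v. Then v m/2^a is a multiple
   of m/2, whose class is killed by d - 1 and so by [N]. *)
move: ncond; rewrite !negb_or !negbK => /and4P[/eqP p2 d1 a2 /dvdzP[v' vE]].
have m2 : (2 %| m)%N by rewrite -p2.
have a2' : (1 < a)%N by rewrite ltnNge.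
have e : exceptional m d.
  apply/andP; split.
    by have := odd_d m2; move: d1; clear; lia.
  by rewrite -[4%N]/(2 ^ 2)%N pfactor_dvdn //; move: a2'; rewrite /a p2.
exists (E (per_incl half_point) *~ v'); split.
+ by apply: span_rep; [exact: half_rep|rewrite half_rank].
+ rewrite -mulrzA half_ann // dvdz_mull //.
  by rewrite /N subrX1 dvdz_mulr.
+ rewrite raddfMz /= tauE -(per_inclM n0); congr per_incl.
  rewrite -[v]zc_val vE /half_point !zcMz mulrC -mulrA; congr (zc _ (_ * _)).
  have a2E : (2 ^ a = m`_p)%N by rewrite p_part -/a p2.
  have mE : (m %/ m`_p * 2 ^ a.-1 * 2 = m)%N.
    by rewrite -mulnA -expnSr prednK ?(ltnW a2') // a2E part_div.
  have -> : (m %/ 2 = m %/ m`_p * 2 ^ a.-1)%N by rewrite -{1}mE mulnK.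
  by rewrite mulnC PoszM PoszX.
Qed.

Lemma part_dvd_order p (v : W) : prime p -> (p %| m)%N ->
  nat_of_ord v = (m %/ m`_p)%N -> (m`_p %| `|(d ^+ #|dorbit d v| - 1)%R|)%N.
Proof.
move=> pp pm vE.
have : (m%:Z %| (v : nat)%:Z * (d ^+ #|dorbit d v| - 1))%Z.
  by rewrite mulrBr mulr1 -zc_eq // -zcMz zc_val dorbit_period.
rewrite vE dvdzE abszM /= -{1}(part_div pp pm).
by rewrite dvdn_pmul2l // divn_gt0 ?part_gt0 // dvdn_leq ?dvdn_part.
Qed.

Lemma index_factor_dvd l : l \in dune_indices ->
  (0 < index_factor l)%N && (index_factor l %| dune_order l)%N.
Proof.
case: l => [[i u] _|v _] /=.
  case: ifP => _; rewrite ?dvd1n // dseq_d_gt0 //=.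
  by rewrite expnS dvdn_mulr // dvdn_gcdr.
have mv : (m%:Z %| (v : nat)%:Z * (d ^+ #|dorbit d v| - 1))%Z.
  rewrite mulrBr mulr1 -zc_eq // -zcMz zc_val.
  by rewrite dorbit_period.
move: mv (@part_dvd_order^~ v).
case: (cfactorP m0 md v) => [p pp pm vE _|e vE|e vE|_ _] mv H.
- by rewrite part_gt0 H.
- have p4 := exceptional_part e; have m2 := exceptional_even e.
  have p2 : (2 %| m`_2)%N by apply: dvdn_trans p4.
  rewrite divn_gt0 // dvdn_leq ?part_gt0 //=.
  by apply: dvdn_trans (H 2%N isT m2 vE); rewrite dvdn_div.
- have m2 := exceptional_even e; move: mv; rewrite vE dvdzE abszM /=.
  rewrite -{1}(divnK m2) dvdn_pmul2l // divn_gt0 // dvdn_leq //.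
- by rewrite dvd1n.
Qed.

Lemma zc_mod_dvd (r : nat) a : (r %| n)%N ->
  (r%:Z %| (zc n a : nat)%:Z)%Z = (r%:Z %| a)%Z.
Proof.
move=> rn; rewrite zc_mod //.
have h : (r%:Z %| (a %/ n)%Z * n%:Z)%Z by rewrite dvdz_mull // dvdzE.
apply/idP/idP => ra; last by rewrite /modz rpredB.
by rewrite (divz_eq a n) rpredD.
Qed.

Lemma coprime_dvd_expr (r : nat) a j : (r %| m)%N ->
  (r%:Z %| a * d ^+ j)%Z = (r%:Z %| a)%Z.
Proof.
move=> rm; rewrite Gauss_dvdzl // coprimezE abszX coprimeXr //=.
exact: coprime_dvdl rm md.
Qed.

(** The relation is read modulo [r]. Chains contribute nothing, as their values are killed by a
    power of [d], a unit modulo [r]; the other cycles vanish by [rX]. Up to the unit d^k only the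
    term of [v] is left. *)
Lemma per_star (r : nat) (v : W) (b : int) y : (r %| m)%N -> v \in X ->
  {in X, forall w, w != v -> (crank d v <= crank d w)%N -> (r %| w)%N} ->
  spanned dune_gens dune_indices
    [pred l | (l != inr v) && (dune_rank (inr v) <= dune_rank l)%N] y ->
  tau (dune_gens (inr v) *~ b + y) = 0 -> (r%:Z %| (v : nat)%:Z * b)%Z.
Proof.
move=> rm vX rX ys; have rn : (r %| n)%N.
  exact: dvdn_trans rm (dseq_dvd n d (leq0n k)).
have ry : (r%:Z %| (tau y : nat)%:Z)%Z.
  move: ys; apply: (@spanned_ind _ _ _ _ _ (fun y => (r%:Z %| (tau y : nat)%:Z)%Z)).
  - by rewrite raddf0 dvdz0.
  - move=> x w xr wr; rewrite raddfB -(zc_val (tau x)) -(zc_val (tau w)) -zcB.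
    by rewrite zc_mod_dvd // rpredB.
  case=> [[i u]|w]; rewrite ?indices_inl ?indices_inr => H /andP[ne le].
    case/andP: H => ik uB; rewrite -(coprime_dvd_expr _ i.+1 rm).
    rewrite -(zc_mod_dvd _ rn) -zcMz zc_val -raddfMz.
    by rewrite (chain_gen_order cP Ed uB) raddf0 dvdz0.
  rewrite /= tauE /per_incl zcMz zc_mod_dvd // coprime_dvd_expr //.
  by rewrite dvdzE; apply: rX.
rewrite raddfD raddfMz /= tauE /per_incl => /eqP; rewrite addr_eq0 => /eqP e.
rewrite -(coprime_dvd_expr _ k rm) mulrAC -(zc_mod_dvd _ rn) -!zcMz.
by rewrite e -(zc_val (tau y)) -zcN zc_mod_dvd // rpredN.
Qed.

(** In [y] the chains are shorter, so d^i kills their values, and the cycles have periodic values.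
    Hence b n_(i+1) d^i is periodic; being killed by [d], it is 0, and n_i = d_i n_(i+1) divides b
    n_(i+1). *)
Lemma tree_star i (b : int) y : (i < k)%N ->
  spanned dune_gens dune_indices
    [pred l | (l != inl (i, us i)) && (dune_rank (inl (i, us i)) <= dune_rank l)%N] y ->
  tau (dune_gens (inl (i, us i)) *~ b + y) = 0 -> ((dd i)%:Z %| b)%Z.
Proof.
move=> ik ys; have [uB [t ti tE]] := usP ik.
have [y1 [y2 [yE y1i y2k]]] : exists y1 y2 : V,
    [/\ tau y = y1 + y2, y1 *~ d ^+ i = 0 & imd k y2].
  have k0 : imd k (0 : V) by apply/imdP; exists 0; rewrite mul0rz.
  move: ys; apply: (@spanned_ind _ _ _ _ _ (fun y => exists y1 y2 : V,
    [/\ tau y = y1 + y2, y1 *~ d ^+ i = 0 & imd k y2])).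
  - by exists 0, 0; rewrite raddf0 addr0 mul0rz.
  - move=> x w [x1 [x2 [xE x1i x2k]]] [w1 [w2 [wE w1i w2k]]].
    exists (x1 - w1), (x2 - w2); split; last exact: imdB.
      by rewrite raddfB /= xE wE opprD addrACA.
    by rewrite mulrzBl x1i w1i subrr.
  case=> [[j w]|w]; rewrite ?indices_inl ?indices_inr => H /andP[ne le].
    case/andP: H => jk wB; exists (tau (chain_gen d c E j w)), 0.
    rewrite addr0; split=> //; move: le; rewrite /= eqxx.
    case: eqP => [we|_]; last by rewrite leqNgt subn_gt0 ik.
    move=> le; have ji : (j < i)%N.
      have : (j <= i)%N by clear -le ik jk; lia.
      rewrite leq_eqVlt => /orP[/eqP e|//]; move: ne.
      by rewrite we e eqxx.
    have e1 : tau (chain_gen d c E j w) *~ d ^+ j.+1 = 0.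
      by rewrite -raddfMz (chain_gen_order cP Ed wB) raddf0.
    by rewrite -(subnKC ji) exprD mulrzA e1 mul0rz.
  exists 0, (per_incl w); rewrite add0r /= tauE mul0rz; split=> //.
  exact: per_incl_imd.
rewrite raddfD raddfMz /= tau_chain tE yE => e.
pose x : V := zc n (nn i.+1) *~ b *~ d ^+ i.
have xk : imd k x.
  have -> : x = - (y2 *~ d ^+ i).
    apply/eqP; rewrite -addr_eq0; apply/eqP.
    have := congr1 (fun z => z *~ d ^+ i) e; rewrite mul0rz => <-.
    by rewrite !mulrzDl y1i add0r [t *~ b *~ _]mulrzAC ti mul0rz addr0.
  rewrite -sub0r; apply: imdB; first by apply/imdP; exists 0; rewrite mul0rz.
  by apply/(imdW _ (imd_mulX i y2k))/leq_addr.
have : x *~ d = 0.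
  rewrite /x -mulrzA -exprSr mulrzAC.
  have -> : zc n (nn i.+1) *~ d ^+ i.+1 = 0 by apply/eqP; rewrite zc_ker.
  by rewrite mul0rz.
move/(imd_inj n0 hk xk)/eqP; rewrite /x zcMz zc_ker // (dseq_mul n d i) PoszM.
by rewrite dvdz_mul2l // -lt0n dseq_gt0.
Qed.

Lemma dune_star : {in dune_indices, forall l, (0 < dune_rank l)%N -> forall b y,
  spanned dune_gens dune_indices
    [pred l' | (l' != l) && (dune_rank l <= dune_rank l')%N] y ->
  tau (dune_gens l *~ b + y) = 0 -> ((index_factor l)%:Z %| b)%Z}.
Proof.
case=> [[i u]|v]; rewrite ?indices_inl ?indices_inr => H rk b y.
  case/andP: H => ik _; have [->|ne] := eqVneq u (us i); last first.
    by move: rk; rewrite /= (negbTE ne).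
  by move=> ys t0; rewrite /index_factor eqxx; apply: tree_star ys t0.
have rdv := @per_star _ v b y _ H; move: rk rdv; rewrite /=.
case: (cfactorP m0 md v) => [p pp pm vE hp|e vE|e vE|//] _ rdv ys t0.
- have : ((m`_p)%N%:Z %| (v : nat)%:Z * b)%Z.
    apply: rdv => //; first exact: dvdn_part.
    move=> w wX wv; case: (cfactorP m0 md w) => // [p' pp' pm' wE _|e wE|e wE] _.
    + rewrite wE; apply: part_dvd_cofactor => //.
      by apply: contra wv => /eqP pE; rewrite -val_eqE /= wE vE pE.
    + rewrite wE; apply: part_dvd_cofactor => //.
      by apply: contra wv => /eqP pE; rewrite -val_eqE /= wE vE pE.
    (* For p = 2 the condition [hp] excludes the exceptional case, so p is odd here and m_p divides
       m/2. *)
    + rewrite wE -(half_part e) dvdn_mulr //; apply: part_dvd_cofactor => //.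
      apply/eqP => p2; move: hp e; rewrite p2 /exceptional /=.
      move=> /orP[d1|/negbTE ->]; last by rewrite andbF.
      by case/andP => d3 _; clear -d1 d3; lia.
  by rewrite vE Gauss_dvdzr // coprimezE cofactor_coprime.
- have p2 : (2 %| m`_2)%N by apply: dvdn_trans (exceptional_part e).
  have r2 : (m`_2 %/ 2 %| m`_2)%N by apply: dvdn_div.
  (* The modulus is only half of m_2, because m/2 may occur in [y] and is divisible by no more than
     that. *)
  have : ((m`_2 %/ 2)%N%:Z %| (v : nat)%:Z * b)%Z.
    apply: rdv => //; first by apply: dvdn_trans r2 _; apply: dvdn_part.
    move=> w wX wv; case: (cfactorP m0 md w) => // [p' pp' pm' wE _|_ wE|_ wE] _.
    + rewrite wE; apply: dvdn_trans r2 _; apply: part_dvd_cofactor => //.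
      by apply: contra wv => /eqP pE; rewrite -val_eqE /= wE vE -pE.
    + by case/eqP: wv; apply: val_inj; rewrite /= wE vE.
    + by rewrite wE -(half_part e) dvdn_mull.
  rewrite vE Gauss_dvdzr // coprimezE; apply: coprime_dvdl r2 _.
  exact: cofactor_coprime.
- have m2 := exceptional_even e.
  (* The full modulus [m] is allowed: m/2 is the only point of rank 2, so [y] contains no cycle. *)
  have : (m%:Z %| (v : nat)%:Z * b)%Z.
    apply: rdv => // w wX wv; case: (cfactorP m0 md w) => // _ wE _.
    by case/eqP: wv; apply: val_inj; rewrite /= wE vE.
  have -> : m%:Z = (m %/ 2)%N%:Z * 2%:Z by rewrite -PoszM divnK.
  by rewrite vE dvdz_mul2l // -lt0n divn_gt0 // dvdn_leq.
Qed.

(** Membership is placed under the quantifier so that a function [z] can be chosen on all indices.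
    For [us i], d_i times the value lies in the kernel of d^i because d_i n_(i+1) = n_i; other
    chains use the kernel of d^(i+1). *)
Lemma dune_correction l : exists z : G, l \in dune_indices ->
  [/\ z *+ kernel_order l = 0,
      spanned dune_gens dune_indices [pred l' | dune_rank l < dune_rank l']%N z &
      tau (dune_gens l *+ index_factor l + z) = 0].
Proof.
have [H|_] := boolP (l \in dune_indices); last by exists 0.
suff [z zP] : exists z : G, [/\ z *+ kernel_order l = 0,
    spanned dune_gens dune_indices [pred l' | dune_rank l < dune_rank l']%N z &
    tau (dune_gens l *+ index_factor l + z) = 0] by exists z.
case: l H => [[i u]|v]; rewrite ?indices_inl ?indices_inr.
  case/andP=> ik uB; have [->|ne] := eqVneq u (us i).
    rewrite /kernel_order /= !eqxx; have [_ [t ti tE]] := usP ik.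
    have [||y [ys yi yE]] := @tree_solve i (tau (chain_gen d c E i (us i)) *+ dd i).
    - exact: ltnW.
    - rewrite tau_chain tE pmulrn !mulrzDl [t *~ _ *~ _]mulrzAC ti mul0rz addr0.
      by apply/eqP; rewrite [zc _ _ *~ (dd i)%:Z]zcMz -PoszM -dseq_mul zc_ker.
    exists (- y); split; first 1 last.
    - by apply: spannedN.
    - by rewrite raddfB raddfMn /= yE subrr.
    have -> : (`|d| ^ i.+1 %/ dd i = `|d| ^ i * (`|d| %/ dd i))%N.
      by rewrite expnSr muln_divA // dvdn_gcdr.
    rewrite mulNrn mulrnA; have := absz_ann yi; rewrite abszX => ->.
    by rewrite mul0rn oppr0.
  rewrite /kernel_order /= (negbTE ne) divn1 mulr1n.
  have [|y [ys yi yE]] := @tree_solve i.+1 (tau (chain_gen d c E i u)) ik.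
    by rewrite -raddfMz (chain_gen_order cP Ed uB) raddf0.
  exists (- y); split; first 1 last.
  - by apply/spannedN/(spanned_sub _ ys) => l _ /=; apply: leq_ltn_trans.
  - by rewrite raddfB /= yE subrr.
  by rewrite mulNrn; have := absz_ann yi; rewrite abszX => ->; rewrite oppr0.
move=> vX; rewrite /kernel_order /=.
have tauM (j : nat) : tau (E (per_incl v) *+ j) = per_incl (v *~ j%:Z).
  by rewrite raddfMn /= tauE pmulrn per_inclM.
have vz (j : nat) : (nat_of_ord v * j = m)%N -> v *~ j%:Z = 0.
  by move=> e; rewrite -(zc_val v) zcMz -PoszM e; apply/eqP; rewrite zc_eq0.
case: (cfactorP m0 md v) => [p pp pm vE _|e vE|e vE|_ _].
- exists 0; split; [by rewrite mul0rn|exact: spanned0|].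
  by rewrite addr0 tauM vz ?per_incl0 // vE part_div.
- have m2 := exceptional_even e; have E4 := exceptional_part e.
  have p2 : (2 %| m`_2)%N by apply: dvdn_trans E4.
  exists (- E (per_incl half_point)); split; first 1 last.
  + apply/spannedN/(@spanned_gen _ _ dune_gens dune_indices _ (inr half_point)).
    * exact: indices_uniq.
    * by rewrite indices_inr half_rep.
    * by rewrite /= half_rank.
  + rewrite raddfB /= tauM tauE -(zc_val v) vE zcMz -PoszM half_part //.
    by rewrite subrr.
  rewrite mulNrn pmulrn half_ann ?oppr0 //.
  set N := `|_|%N.
  have Nfac : (N = `|(d - 1)%R| * `|(\sum_(i < #|dorbit d v|) d ^+ i)%R|)%N.
    by rewrite /N subrX1 abszM.
  (* As d = 3 modulo 4, d - 1 is twice an odd number. So m_2/2 divides the other factor of [N], and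
     d - 1 still divides N/(m_2/2), as [half_ann] requires. *)
  have [w wE] : exists w, (`|(d - 1)%R| = w.*2.+1 * 2)%N.
    exists (`|(d - 1)%R| %/ 4)%N; case/andP: e; clear; lia.
  have N2 : (m`_2 %| N)%N by apply: part_dvd_order.
  have rQ : (m`_2 %/ 2 %| `|(\sum_(i < #|dorbit d v|) d ^+ i)%R|)%N.
    move: N2; rewrite Nfac wE -{1}(divnK p2) mulnAC dvdn_pmul2r // Gauss_dvdr //.
    have : coprime (m`_2)%N w.*2.+1.
      by rewrite p_part coprimeXl // coprime2n /= odd_double.
    by apply: coprime_dvdl; apply: dvdn_div.
  by rewrite Nfac -muln_divA // dvdzE dvdn_mulr.
- have m2 := exceptional_even e.
  exists 0; split; [by rewrite mul0rn|exact: spanned0|].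
  by rewrite addr0 tauM vz ?per_incl0 // vE divnK.
have [y [ys yN yE]] := per_solve v.
exists (- y); split; [|exact: spannedN|].
  by rewrite divn1 mulNrn (absz_ann yN) oppr0.
by rewrite mulr1n raddfB /= tauE yE subrr.
Qed.

Lemma dune_kernel : exists f : {additive cyclic_sum (S_orders X) -> G},
  injective f /\ forall x, (exists y, f y = x) <-> tau x = 0.
Proof.
have /choice[z zP] := dune_correction.
rewrite -map_kernel_order.
have fac l : l \in dune_indices -> (0 < kernel_order l)%N /\ (0 < index_factor l)%N
    /\ dune_order l = (kernel_order l * index_factor l)%N.
  move=> /index_factor_dvd/andP[f0 fd]; rewrite divnK // divn_gt0 // f0.
  by rewrite dvdn_leq ?order_of_gt0.
apply: (@kernel_cyclic_sum _ _ tau dune_index dune_indices dune_gens z dune_order kernel_order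
  index_factor dune_rank indices_uniq).
- by move=> l /fac[].
- by move=> l /fac[_ []].
- by move=> l /fac[_ []].
- exact: gens_order.
- exact: gens_dual.
- exact: gens_generate.
- by move=> l /zP[].
- by move=> l /zP[].
- by move=> l /zP[].
- case=> [[i u]|v]; rewrite ?indices_inl ?indices_inr.
    case/andP=> ik _ /=; case: ifP => // _ /eqP.
    by rewrite subn_eq0 leqNgt ik.
  by move=> _ /=; case: (cfactorP m0 md v).
- exact: dune_star.
Qed.

End Assembly.

(** * The augmentation ideal and its quotients *)

Lemma span_ind (U : zmodType) (s : seq U) (P : span_of s -> Prop) : P 0 ->
  (forall x y, P x -> P y -> P (x - y)) ->
  (forall x : span_of s, val x \in s -> P x) -> forall x, P x.
Proof.
move=> P0 PB Ps x.
pose Q (v : U) := exists2 x : span_of s, val x = v & P x.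
have [y yx Py] : Q (val x).
  apply: (@zspan_ind U Q _ _ s _ (val x) (valP x)).
  - by exists 0; rewrite ?raddf0.
  - by move=> _ _ [a <- Pa] [b <- Pb]; exists (a - b); [rewrite raddfB|apply: PB].
  - move=> v vs; exists (SpanOf (mem_zspan vs)) => //; exact: Ps.
by rewrite -(val_inj yx).
Qed.

Section QuotLift.
Variables (R A : zmodType) (I : zmodClosed R).
Local Notation Q := (Quotient.quot I).

Definition quot_proj : {additive R -> Q} := (\pi_Q)%qT.

Lemma proj_eq0 x : (quot_proj x == 0) = (x \in I).
Proof.
rewrite -[x in RHS]subr0 Quotient.idealrBE.
by have := raddf0 quot_proj; rewrite /quot_proj /= => ->.
Qed.

Lemma proj_surj x : exists y, quot_proj y = x.
Proof. by exists (repr x); rewrite /quot_proj /= reprK. Qed.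

Lemma quot_lift (f : {additive R -> A}) : {in I, forall x, f x = 0} ->
  exists g : {additive Q -> A}, forall x, g (quot_proj x) = f x.
Proof.
move=> fI; have fE x y : quot_proj x = quot_proj y -> f x = f y.
  move=> /eqP; rewrite -subr_eq0 -raddfB proj_eq0 => /fI/eqP.
  by rewrite raddfB subr_eq0 => /eqP.
pose h (x : Q) := f (repr x).
have hE x : h (quot_proj x) = f x by apply: fE; rewrite /quot_proj /= reprK.
have hB : {morph h : x y / x - y}.
  move=> x y; have [x' <-] := proj_surj x; have [y' <-] := proj_surj y.
  by rewrite -raddfB !hE raddfB.
by exists (additive_of hB).
Qed.

End QuotLift.

Section GroupRing.
Variables (n : nat) (d : int).
Hypothesis n0 : (0 < n)%N.
Local Notation V := (Zmod n).
Local Notation Qn := {poly %/ ('X^n - 1 : {poly rat})}.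
Local Notation es := (nonzero_family (@dune_e n)).
Local Notation L := (span_of es).

Let sizeXn1 : size ('X^n - 1 : {poly rat}) = n.+1.
Proof. by rewrite size_XnsubC. Qed.

Let mkE : mk_monic ('X^n - 1 : {poly rat}) = 'X^n - 1.
Proof. by rewrite /mk_monic sizeXn1 ltnS n0 monicXnsubC. Qed.

Lemma xpow_modn (j : nat) : in_qpoly ('X^n - 1) 'X^j = xpow n j :> Qn.
Proof.
rewrite /xpow modz_nat absz_nat {1}(divn_eq j n) exprD mulnC exprM.
rewrite rmorphM rmorphXn /=.
suff -> : in_qpoly ('X^n - 1 : {poly rat}) 'X^n = 1 by rewrite expr1n mul1r.
have : in_qpoly ('X^n - 1 : {poly rat}) ('X^n - 1) = 0.
  by apply: val_inj; rewrite /= mkE Pdiv.RingMonic.rmodpp ?monicXnsubC.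
by rewrite rmorphB rmorph1 => /eqP; rewrite subr_eq0 => /eqP.
Qed.

Lemma xpow_zc a : xpow n a = xpow n (zc n a : nat)%:Z.
Proof. by rewrite /xpow zc_mod // modz_mod. Qed.

Lemma xpowD a b : xpow n a * xpow n b = xpow n (a + b).
Proof.
rewrite [xpow n a]xpow_zc [xpow n b]xpow_zc -!xpow_modn -in_qpolyM -exprD xpow_modn.
rewrite xpow_zc [RHS]xpow_zc; congr (xpow n (nat_of_ord _)%:Z).
by rewrite PoszD zcD !zc_val zcD.
Qed.

Lemma xpow0 : xpow n 0 = 1.
Proof. by rewrite /xpow mod0z expr0 rmorph1. Qed.

Definition qcoef (x : V) (z : Qn) : rat := (z : {poly rat})`_(x : nat).

Lemma cfB x : {morph qcoef x : z w / z - w}.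
Proof. by move=> z w; rewrite /qcoef -coefB. Qed.

Lemma cf0 x : qcoef x 0 = 0.
Proof. by rewrite /qcoef coef0. Qed.

Lemma cf_xpow x a : qcoef x (xpow n a) = (x == zc n a)%:R.
Proof.
have l : ((zc n a : nat) < n)%N by apply: leq_trans (ltn_ord _) _; rewrite prednK.
rewrite xpow_zc /qcoef /xpow modz_nat absz_nat modn_small // in_qpoly_small.
  by rewrite coefXn.
by rewrite mkE size_polyXn sizeXn1.
Qed.

Lemma cf_eq0 z : (forall x, qcoef x z = 0) -> z = 0.
Proof.
move=> cz; apply/npolyP => i; rewrite coef0.
have [li|ni] := ltnP i n; last first.
  by apply: big_coef_npoly; rewrite mkE sizeXn1.
have := cz (inZp i); rewrite /qcoef /= prednK // modn_small //.
Qed.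

Lemma span_shift z : z \in zspan es ->
  forall x, qcoef (x + zc n 1) (xpow n 1 * z) = qcoef x z.
Proof.
move: z; apply: zspan_ind => [x|z w zP wP x|_ /mapP[i _ ->] x].
- by rewrite mulr0 !cf0.
- by rewrite mulrBr !cfB zP wP.
rewrite /dune_e mulrBr xpowD mulr1 -xpow0 !cfB !cf_xpow zcD zc0.
rewrite [zc n 1 + _]addrC (inj_eq (addIr _)).
by rewrite (_ : (x + zc n 1 == zc n 1) = (x == 0)) // -subr_eq0 addrK.
Qed.

Lemma span_aug z : z \in zspan es -> \sum_x qcoef x z = 0.
Proof.
move: z; apply: zspan_ind => [|z w zP wP|_ /mapP[i _ ->]].
- by apply: big1 => x _; apply: cf0.
- under eq_bigr do rewrite cfB.
  by rewrite sumrB zP wP subrr.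
rewrite /dune_e -xpow0; under eq_bigr do rewrite cfB !cf_xpow.
have S (y : V) : \sum_(x : V) (x == y)%:R = 1 :> rat.
  by rewrite (bigD1 y) //= eqxx big1 ?addr0 // => x /negbTE ->.
by rewrite sumrB !S subrr.
Qed.

(** If xz = z, all coefficients of z are equal; their sum is 0, hence so is each of them. *)
Lemma mulX1_inj z : z \in zspan es -> (xpow n 1 - 1) * z = 0 -> z = 0.
Proof.
move=> zs; rewrite mulrBl mul1r => /eqP; rewrite subr_eq0 => /eqP e.
have step x : qcoef (x + zc n 1) z = qcoef x z by rewrite -{1}e span_shift.
have const (i : nat) : qcoef (zc n i) z = qcoef 0 z.
  elim: i => [|i IH]; first by rewrite zc0.
  by rewrite -addn1 PoszD zcD step.
have := span_aug zs; rewrite (eq_bigr (fun=> qcoef 0 z)) => [|x _]; last first.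
  by rewrite -[x in LHS]zc_val const.
rewrite sumr_const card_ord => /eqP; rewrite mulrn_eq0 /= => /eqP c0.
by apply: cf_eq0 => x; rewrite -[x]zc_val const.
Qed.

Lemma span_int z : z \in zspan es -> forall x, qcoef x z \is a Num.int.
Proof.
move: z; apply: zspan_ind => [x|z w zP wP x|_ /mapP[i _ ->] x].
- by rewrite cf0.
- by rewrite cfB rpredB.
by rewrite /dune_e -xpow0 cfB !cf_xpow rpredB // rpred_nat.
Qed.

Definition eL (a : int) : L := SpanOf (dune_e_span a n0).
Definition epsL (a : int) : L := SpanOf (dune_eps_span d a n0).
Definition fL (a : int) : L := SpanOf (lap_f_span d a n0).

Lemma eL_zc a b : zc n a = zc n b -> eL a = eL b.
Proof.
by move=> ab; apply: val_inj; rewrite /= /dune_e [xpow n a]xpow_zc ab -xpow_zc.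
Qed.

Lemma eL0 : eL 0 = 0.
Proof. by apply: val_inj; rewrite /= /dune_e xpow0 subrr. Qed.

Lemma epsLE a : epsL a = eL a *~ d - eL (d * a).
Proof. by apply: val_inj; rewrite raddfB raddfMz. Qed.

Lemma L_ind (P : L -> Prop) : P 0 -> (forall x y, P x -> P y -> P (x - y)) ->
  (forall a, P (eL a)) -> forall x, P x.
Proof.
move=> P0 PB Pe; apply: span_ind => // x /mapP[i _ xi].
by rewrite (_ : x = eL i) //; apply: val_inj.
Qed.

Lemma family_span (g : int -> Qn) (gL : int -> L) (x : L) :
  (forall a, val (gL a) = g a) -> val x \in zspan (nonzero_family g) ->
  forall P : L -> Prop, P 0 -> (forall x y, P x -> P y -> P (x - y)) ->
  (forall i : nat, (0 < i < n)%N -> P (gL i)) -> P x.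
Proof.
move=> gE xs P P0 PB Pg.
pose Q (v : Qn) := exists2 x : L, val x = v & P x.
have [y yx Py] : Q (val x).
  apply: (@zspan_ind _ Q _ _ _ _ (val x) xs).
  - by exists 0; rewrite ?raddf0.
  - by move=> _ _ [a <- Pa] [b <- Pb]; exists (a - b); [rewrite raddfB|apply: PB].
  - move=> _ /mapP[i + ->]; rewrite mem_iota add1n prednK // => ii.
    by exists (gL i); [rewrite gE|apply: Pg].
by rewrite -(val_inj yx).
Qed.

(** The e_v with v nonzero form a basis, and coefficients are read off directly. They are rational
    by type but integers by [span_int], which makes [numq] additive on them. *)
Lemma L_universal (A : zmodType) (phi : V -> A) : phi 0 = 0 ->
  exists f : {additive L -> A}, forall a, f (eL a) = phi (zc n a).
Proof.
move=> phi0; pose F (u : L) : A := \sum_x phi x *~ numq (qcoef x (val u)).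
have nB (a b : rat) : a \is a Num.int -> b \is a Num.int ->
    numq (a - b) = numq a - numq b.
  by move=> /intrP[i ->] /intrP[j ->]; rewrite -rmorphB /= !numq_int.
have FB : {morph F : x y / x - y}.
  move=> u w; rewrite /F -sumrB; apply: eq_bigr => x _.
  by rewrite raddfB /= cfB nB ?mulrzBr // span_int // (valP u, valP w).
exists (additive_of FB) => a; rewrite /= /F /= /dune_e -xpow0.
under eq_bigr => x _ do rewrite cfB nB ?cf_xpow ?rpred_nat // mulrzBr.
have S (y : V) : \sum_(x : V) phi x *~ numq (x == y)%:R = phi y.
  rewrite (bigD1 y) //= eqxx (numq_int 1) mulr1z big1 ?addr0 // => x /negbTE ->.
  by rewrite (numq_int 0) mulr0z.
by rewrite sumrB !S zc0 phi0 subr0.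
Qed.

Lemma eL_val a : eL (zc n a : nat)%:Z = eL a.
Proof. by apply: eL_zc; rewrite zc_val. Qed.

Lemma mulX1_e a : (xpow n 1 - 1) * dune_e n a
  = dune_e n (a + 1) - dune_e n a - dune_e n 1.
Proof.
rewrite /dune_e -xpowD; ring.
Qed.

Lemma mulX1_span z : z \in zspan es -> (xpow n 1 - 1) * z \in zspan es.
Proof.
move: z; apply: zspan_ind => [|z w zP wP|_ /mapP[i _ ->]].
- by rewrite mulr0 rpred0.
- by rewrite mulrBr rpredB.
by rewrite mulX1_e; apply: rpredB; [apply: rpredB|]; exact: dune_e_span.
Qed.

Let mulX_fun (u : L) : L := SpanOf (mulX1_span (valP u)).

Let mulX_B : {morph mulX_fun : x y / x - y}.
Proof. by move=> x y; apply: val_inj; rewrite /= mulrBr. Qed.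

Definition mulX : {additive L -> L} := additive_of mulX_B.

Lemma val_mulX u : val (mulX u) = (xpow n 1 - 1) * val u.
Proof. by []. Qed.

Lemma mulX_inj : injective mulX.
Proof.
apply/raddf_inj => u u0; apply: val_inj; rewrite raddf0.
by apply: mulX1_inj (valP u) _; rewrite -val_mulX u0 raddf0.
Qed.

Lemma mulX_e a : mulX (eL a) = eL (a + 1) - eL a - eL 1.
Proof. by apply: val_inj; rewrite val_mulX mulX1_e !raddfB. Qed.

Lemma mulX1_sum a (r : nat) : (xpow n 1 - 1) * (\sum_(i < r) xpow n (a + i%:Z))
  = xpow n (a + r%:Z) - xpow n a.
Proof.
rewrite mulr_sumr (eq_bigr (fun i : 'I_r => xpow n (a + i.+1%:Z) - xpow n (a + i%:Z))).
  rewrite -(big_mkord xpredT (fun i => xpow n (a + i.+1%:Z) - xpow n (a + i%:Z))).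
  by rewrite telescope_sumr // addr0.
by move=> i _; rewrite mulrBl xpowD mul1r intS addrCA.
Qed.

Lemma mulX_f a : mulX (fL a) = epsL (a + 1) - epsL a.
Proof.
apply: val_inj; rewrite val_mulX raddfB /= /lap_f /dune_eps /dune_e.
have -> : (xpow n (a + 1) - 1) *~ d - (xpow n (d * (a + 1)) - 1)
    - ((xpow n a - 1) *~ d - (xpow n (d * a) - 1))
  = (xpow n (a + 1) - xpow n a) *~ d - (xpow n (d * (a + 1)) - xpow n (d * a)).
  by rewrite !mulrzBl; ring.
have x1 : (xpow n 1 - 1) * (xpow n a *~ d) = (xpow n (a + 1) - xpow n a) *~ d.
  by rewrite mulrzAr mulrBl mul1r xpowD [1 + a]addrC.
case: ifP => d0.
  rewrite mulrBr x1 mulX1_sum; congr (_ - (xpow n _ - _)).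
  by rewrite gez0_abs // mulrDr mulr1.
(* For negative [d] the exponents run upwards from d(a+1) to da, so the telescoped difference has
   the opposite sign. *)
rewrite mulrDr x1 mulX1_sum opprB; congr (_ + (xpow n _ - _)).
have -> : (`|d|%N)%:Z = - d by rewrite ltz0_abs // ltNge d0.
by rewrite mulrDr mulr1 addrK.
Qed.

Local Notation epss := (nonzero_family (dune_eps n d)).
Local Notation fs := (nonzero_family (lap_f n d)).

Definition pE : {additive L -> sand_dune_group n d} := quot_proj (@subspan _ es epss).
Definition pS : {additive L -> S_group n d} := quot_proj (@subspan _ es fs).

Lemma epsL_val a : epsL (zc n a : nat)%:Z = epsL a.
Proof.
rewrite !epsLE eL_val; congr (_ - _); apply: eL_zc.
by rewrite ![d * _]mulrC -!zcMz zc_val.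
Qed.

Lemma family_mem (g : int -> Qn) (gL : int -> L) (a : int) :
  (forall a, val (gL a) = g a) -> (forall a, gL (zc n a : nat)%:Z = gL a) ->
  g 0 \in zspan (nonzero_family g) -> g a \in zspan (nonzero_family g).
Proof.
move=> gE gp g0; rewrite -gE -gp gE; set i := nat_of_ord _.
have [->//|i0] := posnP i.
apply: mem_zspan; apply: (map_f (fun i : nat => g i%:Z)).
by rewrite mem_iota i0 add1n -(prednK n0) ltn_ord.
Qed.

Lemma pE_eps a : pE (epsL a) = 0.
Proof.
apply/eqP; rewrite proj_eq0; apply: (@family_mem _ epsL) => //.
  exact: epsL_val.
have -> : dune_eps n d 0 = 0 :> Qn.
  by rewrite -[LHS]/(val (epsL 0)) epsLE mulr0 eL0 mul0rz subrr raddf0.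
exact: rpred0.
Qed.

Definition dune_class (x : V) : sand_dune_group n d := pE (eL (x : nat)%:Z).

Lemma dune_class_zc a : dune_class (zc n a) = pE (eL a).
Proof. by rewrite /dune_class eL_val. Qed.

Lemma dune_class_0 : dune_class 0 = 0.
Proof. by rewrite -(zc0 n) dune_class_zc eL0 raddf0. Qed.

Lemma dune_class_d x : dune_class x *~ d = dune_class (x *~ d).
Proof.
rewrite -(zc_val x) zcMz !dune_class_zc -raddfMz; apply/eqP; rewrite -subr_eq0 -raddfB.
by rewrite [_ * d]mulrC -epsLE pE_eps.
Qed.

Lemma dune_class_add q (phi : V -> Zmod q) : (0 < q)%N -> phi 0 = 0 ->
  (forall x, phi x *~ d = phi (x *~ d)) ->
  exists lam : {additive sand_dune_group n d -> Zmod q},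
    forall x, lam (dune_class x) = phi x.
Proof.
move=> _ phi0 phid; have [f fE] := L_universal phi0.
have [u us|g gE] := @quot_lift _ _ (@subspan _ es epss) f.
  apply: (@family_span _ epsL u _ us (fun u => f u = 0)) => //.
  - exact: raddf0.
  - by move=> x y fx fy; rewrite raddfB /= fx fy subrr.
  move=> i _; rewrite epsLE raddfB raddfMz /= !fE phid zcMz [d * _]mulrC.
  by rewrite subrr.
by exists g => x; rewrite /dune_class gE fE zc_val.
Qed.

Lemma dune_class_gen (P : sand_dune_group n d -> Prop) : P 0 ->
  (forall x y, P x -> P y -> P (x - y)) -> (forall x, P (dune_class x)) -> forall x, P x.
Proof.
move=> P0 PB PE x; have [u <-] := proj_surj x.
elim/L_ind: u => [|u w Pu Pw|a]; first by rewrite raddf0.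
  by rewrite raddfB; apply: PB.
by have := PE (zc n a); rewrite dune_class_zc.
Qed.

(** Multiplication by x - 1 is injective and turns the sum into the cyclic telescope eps_n - eps_0 =
    0. This accounts for f_0, which is missing from the defining family of S. *)
Lemma sum_f : \sum_(i < n) fL i%:Z = 0.
Proof.
apply: mulX_inj; rewrite raddf0 raddf_sum.
under eq_bigr => i _ do rewrite mulX_f -PoszD addn1.
rewrite -(big_mkord xpredT (fun i : nat => epsL i.+1%:Z - epsL i%:Z)).
have e : zc n n = zc n 0 by apply/eqP; rewrite zc_eq // subr0.
by rewrite telescope_sumr // -[epsL n]epsL_val e epsL_val subrr.
Qed.

Lemma fL_val a : fL (zc n a : nat)%:Z = fL a.
Proof.
apply: mulX_inj; rewrite !mulX_f; congr (_ - _); last exact: epsL_val.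
by rewrite -[LHS]epsL_val -[RHS]epsL_val zcD zc_val -zcD.
Qed.

Lemma pS_f a : pS (fL a) = 0.
Proof.
apply/eqP; rewrite proj_eq0; apply: (@family_mem _ fL) => //.
  exact: fL_val.
have f0 : fL 0 = - \sum_(1 <= i < n) fL i%:Z.
  by apply/eqP; rewrite -addr_eq0 -(big_ltn n0) big_mkord sum_f.
rewrite -[lap_f n d 0]/(val (fL 0)) f0 raddfN raddf_sum rpredN big_nat_cond.
apply: rpred_sum => i /andP[/andP[i0 il] _]; apply: mem_zspan.
by apply: (map_f (fun i : nat => lap_f n d i%:Z)); rewrite mem_iota i0 add1n prednK.
Qed.

(** Injectivity: eps_i is (x - 1)(f_0 + ... + f_(i-1)), so a relation of Sigma in the image comes
    from a relation of S. Image: modulo it e_(a+1) = e_a + e_1, so every element is some c e_1;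
    [tau] forces n | c, and n e_1 = e_n = 0. *)
Lemma S_group_kernel (tau : {additive sand_dune_group n d -> V}) :
  (forall x, tau (dune_class x) = x) ->
  exists mu : {additive S_group n d -> sand_dune_group n d},
    injective mu /\ forall x, (exists y, mu y = x) <-> tau x = 0.
Proof.
move=> tauE.
have [u us|mu muE] := @quot_lift _ _ (@subspan _ es fs) (pE \o mulX).
  apply: (@family_span _ fL u _ us (fun u => pE (mulX u) = 0)) => //.
  - by rewrite !raddf0.
  - by move=> x y fx fy; rewrite !raddfB /= fx fy subrr.
  by move=> i _; rewrite mulX_f raddfB !pE_eps subrr.
have muS u : mu (pS u) = pE (mulX u) := muE u.
exists mu; split=> [|x].
  apply/raddf_inj => y; have [u <-] := proj_surj y; rewrite -/(pS u) muS => /eqP.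
  rewrite proj_eq0 => us.
  have [w wu w0] : exists2 w, mulX w = mulX u & pS w = 0.
    apply: (@family_span _ epsL (mulX u) _ us
      (fun z => exists2 w, mulX w = z & pS w = 0)) => //.
    - by exists 0; rewrite raddf0.
    - move=> x1 x2 [w1 <- p1] [w2 <- p2]; exists (w1 - w2); rewrite raddfB //.
      by rewrite /= p1 p2 subrr.
    move=> i _; exists (\sum_(j < i) fL j%:Z); rewrite raddf_sum; last first.
      by apply: big1 => j _; apply: pS_f.
    under eq_bigr => j _ do rewrite mulX_f -PoszD addn1.
    rewrite -(big_mkord xpredT (fun j : nat => epsL j.+1%:Z - epsL j%:Z)).
    by rewrite telescope_sumr // [epsL 0]epsLE mulr0 eL0 mul0rz !subr0.
  by rewrite -(mulX_inj wu).
pose Im x := exists y, mu y = x.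
have ImB a b : Im a -> Im b -> Im (a - b).
  by move=> [y <-] [z <-]; exists (y - z); rewrite raddfB.
have Im0 : Im 0 by exists 0; rewrite raddf0.
have Ime a : Im (dune_class (zc n (a + 1)) - dune_class (zc n a) - dune_class (zc n 1)).
  by exists (pS (eL a)); rewrite muS mulX_e !dune_class_zc !raddfB.
have tIm y : Im y -> tau y = 0.
  move=> [z <-]; have [u <-] := proj_surj z; rewrite -/(pS u) muS.
  elim/L_ind: u => [|u w Pu Pw|a]; first by rewrite !raddf0.
    by rewrite !raddfB /= Pu Pw subrr.
  by rewrite mulX_e !raddfB /= -!dune_class_zc !tauE zcD addrAC addrK subrr.
split=> [|tx]; first exact: tIm.
have ImE (i : nat) : Im (dune_class (zc n i) - dune_class (zc n 1) *~ i%:Z).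
  elim: i => [|i IH]; first by rewrite zc0 dune_class_0 mulr0z subrr.
  have := closedD Im0 ImB (Ime i%:Z) IH.
  rewrite -PoszD addn1 intS mulrzDr mulr1z; congr Im.
  by rewrite !opprD !addrA; congr (_ - _); rewrite addrAC addrNK.
have [c ImC] : exists c, Im (x - dune_class (zc n 1) *~ c).
  elim/dune_class_gen: x {tx} => [|a b [c1 i1] [c2 i2]|a].
  - by exists 0; rewrite mulr0z subrr.
  - exists (c1 - c2); have := ImB _ _ i1 i2; congr Im.
    by rewrite mulrzBr !opprD opprK !addrA; congr (_ + _); rewrite addrAC.
  - by exists (a : nat)%:Z; have := ImE a; rewrite zc_val.
have : (n%:Z %| c)%Z.
  rewrite -zc_eq0 //; have := tIm _ ImC; rewrite raddfB raddfMz /= tx tauE.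
  by rewrite zcMz mul1r sub0r => /eqP; rewrite oppr_eq0.
move=> /dvdzP[b cE]; rewrite -/(Im x) -(subrK (dune_class (zc n 1) *~ c) x).
apply: (closedD Im0 ImB ImC); rewrite cE mulrC mulrzA.
apply: (closedMz Im0 ImB); have := closedN Im0 ImB (ImE n).
have -> : zc n n = 0 by apply/eqP; rewrite zc_eq0.
by rewrite dune_class_0 sub0r opprK.
Qed.

End GroupRing.

(** * Sandpile groups *)

Lemma cyclic_sum_torsion (s : seq nat) (x : cyclic_sum s) :
  exists2 r : nat, (0 < r)%N & x *+ r = 0.
Proof.
elim: s x => [|q s IH] /= x.
  by exists 1%N => //; apply: val_inj; case: (x *+ 1) => [] [].
case: x => a b; have [r r0 br] := IH b; exists (q.-1.+1 * r)%N.
  by rewrite muln_gt0.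
rewrite pairMnE /=.
have -> : b *+ (q.-1.+1 * r) = 0 by rewrite mulnC mulrnA br mul0rn.
suff -> : a *+ (q.-1.+1 * r) = 0 by [].
by apply: val_inj; rewrite Zp_mulrn /= mulnCA modnMr.
Qed.

Section Laplacian.
Variables (N : nat) (D : digraph N) (A : zmodType) (g : 'I_N -> A).

Lemma laplacian_row w : \sum_u g u *~ laplacian D w u
  = g w *+ outdegree D w - \sum_(a : Defs.arc D | src a == w) g (tgt a).
Proof.
under eq_bigr => u _ do rewrite !mxE mulrzBr.
rewrite sumrB; congr (_ - _).
  rewrite (bigD1 w) //= eqxx mulr1n big1 ?addr0 // => u /negbTE.
  by rewrite eq_sym => ->; rewrite mulr0n mulr0z.
rewrite (partition_big (@tgt _ D) predT) //=; apply: eq_bigr => u _.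
rewrite (eq_bigr (fun=> g u)); last by move=> a /andP[_ /eqP ->].
rewrite sumr_const -pmulrn; congr (_ *+ _).
by apply: eq_card => a; rewrite inE.
Qed.

End Laplacian.

Lemma laplacian_row_sum N (D : digraph N) w : \sum_u laplacian D w u = 0.
Proof.
have := laplacian_row D (fun=> 1 : int) w; rewrite sumr_const.
under eq_bigr => u _ do rewrite intz.
move=> ->; apply/eqP; rewrite subr_eq0; apply/eqP; congr (_ *+ _).
by apply: eq_card => a; rewrite inE.
Qed.

Section Sandpile.
Variables (n : nat) (d : int).
Hypothesis n0 : (0 < n)%N.
Local Notation V := (Zmod n).
Local Notation es := (nonzero_family (@dune_e n)).
Local Notation L := (span_of es).
Local Notation eL := (eL n0).
Local Notation fL := (fL d n0).
Local Notation pS := (pS n d).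

Section Matrix.
(** The sign [sg] is 1 for de Bruijn graphs and -1 for Kautz graphs, whose Laplacian rows represent
    -f_w. *)
Variables (M : 'M[int]_(n.-1.+1)) (sg : int) (v : V).
Hypothesis sg2 : sg * sg = 1.
Hypothesis M0 : forall w, \sum_u M w u = 0.
Hypothesis Mf : forall w : V,
  \sum_(u : V) eL (u : nat)%:Z *~ M w u = fL (w : nat)%:Z *~ sg.
Local Notation Mv := (row' v (col' v M)).

(** The identification of Z^(n-1) with the augmentation ideal based at [v]: a vertex w goes to x^w -
    x^v. As Laplacian rows sum to 0, deleting column [v] loses nothing. *)
Let Phi_fun (r : 'rV[int]_n.-1) : L :=
  \sum_j (eL (lift v j : nat)%:Z - eL (v : nat)%:Z) *~ r 0 j.

Let Phi_B : {morph Phi_fun : x y / x - y}.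
Proof.
move=> x y; rewrite /Phi_fun -sumrB; apply: eq_bigr => j _.
by rewrite !mxE mulrzBr.
Qed.

Let Phi : {additive 'rV[int]_n.-1 -> L} := additive_of Phi_B.

Let PhiE r : Phi r = \sum_j (eL (lift v j : nat)%:Z - eL (v : nat)%:Z) *~ r 0 j.
Proof. by []. Qed.

Let PhiZ a r : Phi (a *: r) = Phi r *~ a.
Proof.
rewrite !PhiE mulrz_suml; apply: eq_bigr => j _.
by rewrite mxE mulrC mulrzA.
Qed.

Let Phi_delta j : Phi (delta_mx 0 j) = eL (lift v j : nat)%:Z - eL (v : nat)%:Z.
Proof.
rewrite PhiE (bigD1 j) //= mxE !eqxx mulr1z big1 ?addr0 // => i /negbTE ij.
by rewrite mxE ij andbF mulr0z.
Qed.

Let Phi_row i : Phi (row i Mv) = fL (lift v i : nat)%:Z *~ sg.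
Proof.
rewrite -Mf PhiE.
have -> : \sum_(u : V) eL (u : nat)%:Z *~ M (lift v i) u
    = \sum_(u : V) (eL (u : nat)%:Z - eL (v : nat)%:Z) *~ M (lift v i) u.
  under [RHS]eq_bigr => u _ do rewrite mulrzBl.
  by rewrite sumrB -(mulrz_sumr (eL (v : nat)%:Z)) M0 mulr0z subr0.
rewrite (bigD1_ord v) //= subrr mul0rz add0r; apply: eq_bigr => j _.
by rewrite !mxE.
Qed.

Let Phi_mul (w : 'rV_n.-1) : Phi (w *m Mv) = \sum_i Phi (row i Mv) *~ w 0 i.
Proof.
by rewrite mulmx_sum_row raddf_sum; apply: eq_bigr => i _; rewrite PhiZ.
Qed.

Let Phi_inj : injective Phi.
Proof.
apply/raddf_inj => r r0; apply/rowP => j; rewrite mxE.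
have cfM x z (a : int) : @qcoef n x (z *~ a) = qcoef x z *~ a.
  exact: (raddfMz (additive_of (@cfB n x))).
have cfS x (F : 'I_n.-1 -> _) : @qcoef n x (\sum_j F j) = \sum_j qcoef x (F j).
  exact: (raddf_sum (additive_of (@cfB n x))).
have := congr1 (fun u : L => qcoef (lift v j) (val u)) r0.
rewrite raddf0 cf0 PhiE raddf_sum cfS.
have vB a b : val (eL a - eL b) = dune_e n a - dune_e n b by [].
have T i : qcoef (lift v j) (val ((eL (lift v i : nat)%:Z - eL (v : nat)%:Z) *~ r 0 i))
    = (j == i)%:R *~ r 0 i.
  rewrite raddfMz cfM; congr (_ *~ _).
  rewrite [X in qcoef _ X]vB /dune_e opprB addrA subrK.
  rewrite cfB !cf_xpow // !zc_val (inj_eq lift_inj) [_ == v]eq_sym.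
  by rewrite (negbTE (neq_lift _ _)) subr0.
under eq_bigr => i _ do rewrite T.
rewrite (bigD1 j) //= eqxx big1 ?addr0 => [|i /negbTE]; last first.
  by rewrite eq_sym => ->; rewrite mul0rz.
by move/eqP; rewrite intr_eq0 => /eqP.
Qed.

Lemma sum_fV : \sum_(u : V) fL (u : nat)%:Z = 0.
Proof.
by rewrite -(big_mkord xpredT (fun i : nat => fL i)) prednK // big_mkord sum_f.
Qed.

Lemma cokernel_S_group : exists2 ka : {additive cokernel Mv -> S_group n d},
  injective ka & forall s, exists x, ka x = s.
Proof.
have [r|ka kaE] := @quot_lift _ _ (row_lattice Mv) (pS \o Phi).
  move=> /asboolP[w ->]; transitivity (pS (Phi (w *m Mv))) => //.
  rewrite Phi_mul raddf_sum big1 // => i _.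
  by rewrite Phi_row !raddfMz /= pS_f !mul0rz.
have kaP r : ka (quot_proj (row_lattice Mv) r) = pS (Phi r) := kaE r.
exists ka.
  apply/raddf_inj => y; have [r <-] := proj_surj y; rewrite kaP => /eqP.
  rewrite proj_eq0 => rs; apply/eqP; rewrite proj_eq0; apply/asboolP.
  pose P z := exists w : 'rV_n.-1, z = Phi (w *m Mv).
  have P0 : P 0 by exists 0; rewrite mul0mx raddf0.
  have PB x z : P x -> P z -> P (x - z).
    by move=> [w1 ->] [w2 ->]; exists (w1 - w2); rewrite mulmxBl raddfB.
  have Pl i : P (fL (lift v i : nat)%:Z).
    exists (sg *: delta_mx 0 i); rewrite -scalemxAl PhiZ -rowE Phi_row.
    by rewrite -mulrzA sg2 mulr1z.
  (* The deleted row is recovered as minus the sum of the others. *)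
  have Pf (u : V) : P (fL (u : nat)%:Z).
    have [i ->|->] := unliftP v u; first exact: Pl.
    have := sum_fV; rewrite (bigD1_ord v) // => /eqP; rewrite addr_eq0 => /eqP ->.
    by apply: (closedN P0 PB); apply: (closed_sum P0 PB) => j _; apply: Pl.
  have [w wE] : P (Phi r).
    apply: (@family_span n n0 _ fL (Phi r) _ rs P P0 PB) => // i _.
    by rewrite -fL_val; apply: Pf.
  by exists w; apply: Phi_inj.
pose P s := exists x, ka x = s.
have P0 : P 0 by exists 0; rewrite raddf0.
have PB x z : P x -> P z -> P (x - z).
  by move=> [w1 <-] [w2 <-]; exists (w1 - w2); rewrite raddfB.
have Pu (u : V) : P (pS (eL (u : nat)%:Z - eL (v : nat)%:Z)).
  have [i ->|->] := unliftP v u; last by rewrite subrr raddf0.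
  by exists (quot_proj (row_lattice Mv) (delta_mx 0 i)); rewrite kaP Phi_delta.
have Pv : P (pS (eL (v : nat)%:Z)).
  by have := closedN P0 PB (Pu 0); rewrite -raddfN eL0 sub0r opprK.
move=> s; have [u <-] := proj_surj s; rewrite -/(pS u) -/(P _).
move: u; apply: (@L_ind n n0) => [|u w Hu Hw|a]; first by rewrite raddf0.
  by rewrite raddfB; apply: PB.
by have := closedD P0 PB (Pu (zc n a)) Pv; rewrite -raddfD subrK eL_val.
Qed.

End Matrix.

Lemma sandpile_isog (D : digraph n.-1.+1) (v : V) (sg : int) : sg * sg = 1 ->
  (forall w : V, \sum_(u : V) eL (u : nat)%:Z *~ laplacian D w u
     = fL (w : nat)%:Z *~ sg) ->
  (forall x : S_group n d, exists2 r : nat, (0 < r)%N & x *+ r = 0) ->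
  zmod_isog (sandpile_group D v) (S_group n d).
Proof.
move=> sg2 Df tors.
have [ka kaI kaS] := cokernel_S_group v sg2 (@laplacian_row_sum _ D) Df.
pose f := (ka \o val : sandpile_group D v -> S_group n d).
have fB : {morph f : x y / x - y} by move=> x y; rewrite /f /= !raddfB.
apply: (zmod_isog_same_image (f := additive_of fB) (g := idfun)) => //.
  by move=> x y /kaI/val_inj.
move=> s; split=> _; first by exists s.
have [x xs] := kaS s; have tx : x \in @torsion (cokernel (reduced_laplacian D v)).
  apply/asboolP; have [r r0 sr] := tors s; exists r => //.
  by apply: kaI; rewrite raddfMn raddf0 /= xs.
by exists (TorsionSubgroup tx); rewrite /f /= xs.
Qed.

Lemma fL_pos a : 0 <= d ->
  fL a = eL a *~ d - \sum_(i < `|d|%N) eL (d * a + i%:Z).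
Proof.
move=> d0; apply: val_inj; rewrite raddfB raddfMz raddf_sum /= /lap_f d0 /dune_e.
rewrite sumrB mulrzBl sumr_const card_ord pmulrn gez0_abs //.
by rewrite opprB addrA subrK.
Qed.

Lemma fL_neg a : d < 0 ->
  fL a = eL a *~ d + \sum_(i < `|d|%N) eL (d * (a + 1) + i%:Z).
Proof.
move=> d0; apply: val_inj; rewrite raddfD raddfMz raddf_sum /=.
rewrite /lap_f leNgt d0 /dune_e /=.
rewrite sumrB mulrzBl sumr_const card_ord pmulrn ltz0_abs // mulrNz opprK.
by rewrite addrA addrAC subrK.
Qed.

Lemma arc_sum (A : zmodType) (r : nat) (w : V) (F : V * 'I_r -> A) :
  \sum_(a | a.1 == w) F a = \sum_i F (w, i).
Proof.
rewrite (reindex_onto (fun i => (w, i)) snd) /=; last by move=> [x i] /= /eqP ->.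
by apply: eq_bigl => i; rewrite !eqxx.
Qed.

Lemma arc_card (r : nat) (w : V) : #|[set a : V * 'I_r | a.1 == w]| = r.
Proof.
rewrite -sum1_card -[RHS]card_ord -sum1_card.
rewrite (reindex_onto (fun i => (w, i)) snd) /=; last first.
  by move=> [x i]; rewrite inE /= => /eqP ->.
by apply: eq_bigl => i; rewrite !inE /= !eqxx.
Qed.

Lemma eL_eq_zc (x : V) a : x = zc n a -> eL (x : nat)%:Z = eL a.
Proof. by move=> ->; rewrite eL_val. Qed.

Lemma DB_row (w : V) : 0 <= d ->
  \sum_(u : V) eL (u : nat)%:Z *~ laplacian (DB n `|d|) w u = fL (w : nat)%:Z *~ 1.
Proof.
move=> d0; rewrite laplacian_row.
have -> : outdegree (DB n `|d|) w = `|d|%N := arc_card _ w.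
pose F (a : V * 'I_`|d|) : L := eL (nat_of_ord (a.1 *+ `|d| + inZp a.2)%R)%:Z.
have -> : \sum_(a : Defs.arc (DB n `|d|) | src a == w) eL (nat_of_ord (tgt a))%:Z
    = \sum_i F (w, i) := arc_sum w F.
rewrite mulr1z fL_pos // pmulrn gez0_abs //; congr (_ - _).
apply: eq_bigr => i _; apply: eL_eq_zc.
by rewrite zcD zc_nat mulrC -zcMz zc_val pmulrn gez0_abs.
Qed.

Lemma Ktz_row (w : V) : d < 0 ->
  \sum_(u : V) eL (u : nat)%:Z *~ laplacian (Ktz n `|d|) w u
    = fL (w : nat)%:Z *~ (-1).
Proof.
move=> d0; rewrite laplacian_row.
have -> : outdegree (Ktz n `|d|) w = `|d|%N := arc_card _ w.
pose F (a : V * 'I_`|d|) : L :=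
  eL (nat_of_ord (- ((a.1 + inZp 1) *+ `|d|) + inZp a.2)%R)%:Z.
have -> : \sum_(a : Defs.arc (Ktz n `|d|) | src a == w) eL (nat_of_ord (tgt a))%:Z
    = \sum_i F (w, i) := arc_sum w F.
rewrite mulrNz mulr1z fL_neg // opprD pmulrn ltz0_abs // mulrNz; congr (_ - _).
apply: eq_bigr => i _; apply: eL_eq_zc.
rewrite zcD zc_nat mulrC -zcMz zcD zc_val pmulrn ltz0_abs // mulrNz opprK.
by rewrite [zc n 1]zc_nat.
Qed.

End Sandpile.

Theorem theorem3p1 (n : nat) (d : int) (hn : (1 <= n)%N) (hd : (2 <= `|d|)%N)
    (k : nat) (hk : dseq_stop n d k)
    (X : {set Zmod (dseq_n n d k)}) (hX : orbit_representatives d X) :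
  [/\ 2 <= d ->
        forall v, zmod_isog (sandpile_group (DB n `|d|%N) v) (S_group n d),
      d <= - 2%:Z ->
        forall v, zmod_isog (sandpile_group (Ktz n `|d|%N) v) (S_group n d),
      zmod_isog (sand_dune_group n d) (cyclic_sum (sigma_orders X))
    & zmod_isog (S_group n d) (cyclic_sum (S_orders X))].
Proof.
have E0 := dune_class_0 d hn; have Ed := @dune_class_d n d hn.
have Ea := @dune_class_add n d hn; have Eg := @dune_class_gen n d hn.
have [c cP] := deep_section hn hk.
have /choice[us usP] : forall i, exists u, (i < k)%N -> u \in chain_end d c i /\
    exists2 y : Zmod n, y *~ d ^+ i = 0 &
      iter i c u - iter i.+1 c (u *~ d) = zc n (dseq_n n d i.+1) + y.
  move=> i; have [ik|_] := boolP (i < k)%N; last by exists 0.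
  by have [u uB ue] := chain_end_jump hn hk cP ik; exists u.
have [tau tauE] := Ea n id hn erefl (fun=> erefl).
have [f [fI fim]] := dune_kernel hn hd hk hX E0 Ed Ea Eg cP usP tauE.
have [mu [muI muim]] := S_group_kernel tauE.
have SI : zmod_isog (S_group n d) (cyclic_sum (S_orders X)).
  by apply: (zmod_isog_same_image muI fI) => x; rewrite muim fim.
(* S is a torsion group by its decomposition, so the torsion subgroup of the cokernel is the whole
   cokernel. *)
have tors (x : S_group n d) : exists2 r : nat, (0 < r)%N & x *+ r = 0.
  have [g [h gK _]] := SI; have [r r0 gr] := cyclic_sum_torsion (g x).
  by exists r => //; apply: (can_inj gK); rewrite raddfMn raddf0.
split=> // [d2 v|d2 v|].
- apply: (sandpile_isog v (mulr1 1)) tors => w; apply: DB_row.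
  exact: le_trans d2.
- apply: (sandpile_isog v (_ : -1 * -1 = 1)) tors => // w; apply: Ktz_row.
  exact: le_lt_trans d2 _.
- exact: (dune_isog hn hd hk hX E0 Ed Ea Eg cP usP).
Qed.
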